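(* Let $n\ge 3$, $k\in\{2,\dots,n-1\}$, $r>0$, and let $M(r)$ be the tube of radius $r$ around $W^{2n-k}=W^{2n-k}_{\pi/2}$ in $\mathbb{C}H^n$. Then $M(r)$ has four principal curvatures (with respect to the unit normal pointing towards $W^{2n-k}$) $$\lambda_{1}=\tfrac34\tanh\tfrac r2-\tfrac12\sqrt{1-\tfrac34\tanh^2\tfrac r2},\quad \lambda_{2}=\tfrac34\tanh\tfrac r2+\tfrac12\sqrt{1-\tfrac34\tanh^2\tfrac r2},\quad \lambda_3=\tfrac12\tanh\tfrac r2,\quad \lambda_4=\tfrac12\coth\tfrac r2$$ with corresponding multiplicities $m_1=m_2=1$, $m_3=2n-2-k$ and $m_4=k-1$. The Hopf vector field on $M(r)$ has nontrivial orthogonal projection onto the principal curvature spaces of $\lambda_1$ and $\lambda_2$. A special situation occurs when $r=\ln(2+\sqrt3)$: in this case $\lambda_2=\lambda_4$ and the principal curvatures are $\lambda_1=0$, $\lambda_2=\lambda_4=\sqrt3/2$ and $\lambda_3=\sqrt3/6$ with multiplicities $1$, $k$ and $2n-k-2$, respectively.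
   Context: $\mathbb{C}H^n$ is complex hyperbolic space with its metric of constant holomorphic sectional curvature $-1$ and complex structure $J$. A real linear subspace $V$ of a complex vector space with compatible inner product has constant Kähler angle $\varphi$ if for every nonzero $v\in V$ the orthogonal projection of $Jv$ onto $V$ has length $\cos(\varphi)\|v\|$; $\varphi=\pi/2$ means $V$ is totally real ($JV\perp V$). Definition of $W^{2n-k}_\varphi$: fix $o\in\mathbb{C}H^n$ and a point $x$ in the ideal boundary, and let $SU(1,n)=KAN$ be the corresponding Iwasawa decomposition. $AN$ acts simply transitively on $\mathbb{C}H^n$, so $\mathbb{C}H^n$ is identified with $AN$ with a left-invariant metric and left-invariant $J$, and its Lie algebra $\mathfrak{a}+\mathfrak{n}=\mathfrak{a}+\mathfrak{g}_\alpha+\mathfrak{g}_{2\alpha}$ (orthogonal sum) with $T_o\mathbb{C}H^n$. Here $\mathfrak{a}=\mathbb{R}B$ with $B$ the unit vector at $o$ pointing to $x$, $\mathfrak{g}_{2\alpha}=\mathbb{R}Z$ with $Z=JB$, $\mathfrak{g}_\alpha\cong\mathbb{C}^{n-1}$ is $J$-invariant, and the nontrivial brackets are $[B,Z]=Z$, $2[B,U]=U$, $[U,V]=\langle JU,V\rangle Z$ for $U,V\in\mathfrak{g}_\alpha$. Let $\mathfrak{w}\subset\mathfrak{g}_\alpha$ be a real linear subspace whose orthogonal complement $\mathfrak{w}^\perp=\mathfrak{g}_\alpha\ominus\mathfrak{w}$ has real dimension $k$ and constant Kähler angle $\varphi$; let $S\subset AN$ be the connected closed subgroup with Lie algebra $\mathfrak{s}=\mathfrak{a}+\mathfrak{w}+\mathfrak{g}_{2\alpha}$.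 Then $W^{2n-k}_\varphi:=S\cdot o$. The tube of radius $r$ around a submanifold $W$ is $M(r)=\{\exp(r\xi):\xi\in\nu W,\ \|\xi\|=1\}$, with $\exp$ the Riemannian exponential map. At $p=\gamma_\xi(r)$, where $\gamma_\xi(t)=\exp(t\xi)$, the unit normal pointing towards $W$ is $-\dot\gamma_\xi(r)$. The Hopf vector field on $M(r)$ is $J$ applied to the unit normal field. The shape operator with respect to a unit normal field $\eta$ is $\mathcal{S}_\eta X=-(\bar\nabla_X\eta)^{\top}$, where $\bar\nabla$ is the Levi-Civita connection of $\mathbb{C}H^n$ and $\top$ denotes the tangential component; principal curvatures are its eigenvalues. *)

(* Defs.v *)
From HB Require Import structures.
From mathcomp Require Import all_boot all_order all_algebra.
From mathcomp Require Import all_classical all_reals all_analysis.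
From mathcomp Require Import ring.
Set Implicit Arguments.
Unset Strict Implicit.
Unset Printing Implicit Defensive.
Import Order.TTheory GRing.Theory Num.Theory.
Import numFieldNormedType.Exports.
Local Open Scope classical_set_scope.
Local Open Scope ring_scope.

Section Preliminaries.
Context {R : realType}.

Definition tanh (x : R) : R :=
  (expR x - expR (- x)) / (expR x + expR (- x)).

Definition coth (x : R) : R :=
  (expR x + expR (- x)) / (expR x - expR (- x)).

Definition dot {N : nat} (u v : 'rV[R]_N) : R := \sum_(i < N) u 0 i * v 0 i.

(* [y] is the orthogonal projection of [x] onto the linear subspace [P], for
   the inner product [ip]. *)
Definition orth_proj {N : nat} (ip : 'rV[R]_N -> 'rV[R]_N -> R)
    (P : set 'rV[R]_N) (x y : 'rV[R]_N) : Prop :=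
  P y /\ forall z, P z -> ip (x - y) z = 0.

Definition has_dim {N : nat} (P : set 'rV[R]_N) (d : nat) : Prop :=
  exists E : {vspace 'rV[R]_N}, P = [set` E] /\ \dim E = d.

(* On an open set [O] this is C^infinity: every iterated directional
   derivative is (Frechet) differentiable, hence continuous, on [O]. *)
Definition smooth_on {N : nat} {W : normedModType R} (O : set 'rV[R]_N)
    (f : 'rV[R]_N -> W) : Prop :=
  forall (vs : seq 'rV[R]_N) (x : 'rV[R]_N), O x ->
    differentiable (foldr (fun v (h : 'rV[R]_N -> W) x => 'D_v h x) f vs) x.

Definition tangent {N : nat} (M : set 'rV[R]_N) (p : 'rV[R]_N)
    : set 'rV[R]_N :=
  [set X | exists c : R -> 'rV[R]_N,
     [/\ c 0 = p, \forall s \near 0, M (c s), derivable c 0 1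
       & derive1 c 0 = X]].

Definition smooth_hypersurface {N : nat} (M : set 'rV[R]_N) : Prop :=
  forall p, M p -> exists (O : set 'rV[R]_N) (f : 'rV[R]_N -> R),
    [/\ open O, O p, smooth_on O f,
        forall q, O q -> (M q <-> f q = 0)
      & forall q, O q -> M q -> exists v, 'D_v f q != 0].

End Preliminaries.

(* Riemannian geometry of R^N with a metric [g]: [g p] is the inner product on
   the tangent space at [p], and every tangent space is R^N. *)
Section Riemannian.
Context {R : realType} {N : nat}.
Notation V := 'rV[R]_N.
Variable g : V -> V -> V -> R.

Definition gram (p : V) : 'M[R]_N :=
  \matrix_(i, j) g p (delta_mx 0 i) (delta_mx 0 j).

Definition dgram (i j l : 'I_N) (p : V) : R :=
  'D_(delta_mx 0 i) (fun q => gram q j l) p.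

Definition christoffel (p : V) (i j l : 'I_N) : R :=
  2^-1 * \sum_(h < N) invmx (gram p) l h *
           (dgram i j h p + dgram j i h p - dgram h i j p).

Definition Gamma (p X Y : V) : V :=
  \row_l \sum_(i < N) \sum_(j < N) christoffel p i j l * X 0 i * Y 0 j.

(* Covariant derivative at [p] of the vector field [Y] in the direction [X],
   for the Levi-Civita connection. *)
Definition nabla (X : V) (Y : V -> V) (p : V) : V :=
  'D_X Y p + Gamma p X (Y p).

Definition is_geodesic (c : R -> V) : Prop :=
  forall s, [/\ derivable c s 1, derivable (derive1 c) s 1
    & derive1 (derive1 c) s + Gamma (c s) (derive1 c s) (derive1 c s) = 0].

Definition normal (M : set V) (p : V) : set V :=
  [set xi | forall X, tangent M p X -> g p xi X = 0].

(* [c s = exp (s xi)] for a unit normal vector [xi = c'(0)] of [W]. *)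
Definition unit_normal_geodesic (W : set V) (c : R -> V) : Prop :=
  [/\ is_geodesic c, W (c 0), normal W (c 0) (derive1 c 0)
    & g (c 0) (derive1 c 0) (derive1 c 0) = 1].

Definition tube (W : set V) (r : R) : set V :=
  [set p | exists2 c, unit_normal_geodesic W c & c r = p].

(* Smooth vector field on a neighbourhood of the tube of radius [r] around [W]
   whose restriction to the tube is the unit normal pointing towards [W]. *)
Definition inward_unit_normal (W : set V) (r : R) (eta : V -> V) : Prop :=
  (exists O, [/\ open O, tube W r `<=` O & smooth_on O eta]) /\
  forall p, tube W r p ->
    exists c, [/\ unit_normal_geodesic W c, c r = p & eta p = - derive1 c r].

(* [Y = S_eta X] at [p]. *)
Definition shape (M : set V) (eta : V -> V) (p X Y : V) : Prop :=
  orth_proj (g p) (tangent M p) (- nabla X eta p) Y.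

Definition principal_space (M : set V) (eta : V -> V) (p : V) (lambda : R)
    : set V :=
  [set X | tangent M p X /\ shape M eta p X (lambda *: X)].

Definition principal_curvature (M : set V) (eta : V -> V) (p : V) : set R :=
  [set lambda | exists2 X, principal_space M eta p lambda X & X != 0].

End Riemannian.

(* Complex hyperbolic space of complex dimension [m + 1], as the group AN with
   its left-invariant metric. *)
Section ComplexHyperbolic.
Context {R : realType} {m : nat}.

(* C^m = R^m + i R^m *)
Notation Ga := 'rV[R]_(m + m).
(* a + g_alpha + g_{2 alpha}; also the underlying manifold of AN *)
Notation V := 'rV[R]_(1 + (m + m) + 1).

Definition Ja (U : Ga) : Ga := row_mx (- rsubmx U) (lsubmx U).

Definition orthc (w : {vspace Ga}) : set Ga :=
  [set v | forall u, u \in w -> dot v u = 0].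

Definition constant_kahler_angle (P : set Ga) (phi : R) : Prop :=
  forall v u, P v -> v != 0 -> orth_proj dot P (Ja v) u ->
    Num.sqrt (dot u u) = cos phi * Num.sqrt (dot v v).

(* [mk t U z] is t B + U + z Z in the Lie algebra, and
   Exp(U + z Z) Exp(t B) in the group. *)
Definition mk (t : R) (U : Ga) (z : R) : V :=
  row_mx (row_mx t%:M U) z%:M.
Definition ca (p : V) : R := lsubmx (lsubmx p) 0 0.
Definition cU (p : V) : Ga := rsubmx (lsubmx p).
Definition cz (p : V) : R := rsubmx p 0 0.

Definition B : V := mk 1 0 0.
Definition Z : V := mk 0 0 1.

Definition J0 (X : V) : V := mk (- cz X) (Ja (cU X)) (ca X).

(* AN is the simply connected group whose brackets are [B, Z] = Z,
   2 [B, U] = U and [U, V] = <J U, V> Z: see [bracket_mk] below. *)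
Definition gone : V := 0.
Definition gmul (p q : V) : V :=
  mk (ca p + ca q)
     (cU p + expR (ca p / 2) *: cU q)
     (cz p + expR (ca p) * cz q
      + 2^-1 * expR (ca p / 2) * dot (Ja (cU p)) (cU q)).
Definition ginv (p : V) : V :=
  mk (- ca p) (- (expR (- ca p / 2) *: cU p)) (- (expR (- ca p) * cz p)).

(* The differential at the identity of left translation by [p], and the
   differential at [p] of left translation by the inverse of [p]. *)
Definition dL (p X : V) : V := 'D_X (gmul p) gone.
Definition dLinv (p X : V) : V := 'D_X (gmul (ginv p)) p.

Definition gCH (p X Y : V) : R := dot (dLinv p X) (dLinv p Y).
Definition J (p X : V) : V := dL p (J0 (dLinv p X)).

Lemma ca_mk t U z : ca (mk t U z) = t.
Proof. by rewrite /ca /mk !row_mxKl mxE. Qed.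

Lemma cU_mk t U z : cU (mk t U z) = U.
Proof. by rewrite /cU /mk row_mxKl row_mxKr. Qed.

Lemma cz_mk t U z : cz (mk t U z) = z.
Proof. by rewrite /cz /mk row_mxKr mxE. Qed.

Definition mkK := (ca_mk, cU_mk, cz_mk).

Lemma mk_eta p : mk (ca p) (cU p) (cz p) = p.
Proof.
rewrite /mk /ca /cU /cz -[RHS]hsubmxK -[lsubmx p in RHS]hsubmxK.
by congr (row_mx (row_mx _ _) _); rewrite [LHS]mx11_scalar mxE eqxx mulr1n -mx11_scalar.
Qed.

Lemma mkD t U z s T y : mk t U z + mk s T y = mk (t + s) (U + T) (z + y).
Proof. by rewrite /mk !add_row_mx !raddfD. Qed.

Lemma mkZ (h t : R) U z : h *: mk t U z = mk (h * t) (h *: U) (h * z).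
Proof. by rewrite /mk !scale_row_mx !scale_scalar_mx. Qed.

Lemma mkN t U z : - mk t U z = mk (- t) (- U) (- z).
Proof. by rewrite -scaleN1r mkZ !mulN1r scaleN1r. Qed.

Lemma gone_mk : gone = mk 0 0 0.
Proof. by rewrite /gone /mk !raddf0 !row_mx0. Qed.

Lemma dotDr (u v v' : Ga) : dot u (v + v') = dot u v + dot u v'.
Proof. by rewrite /dot -big_split; apply: eq_bigr => i _; rewrite mxE mulrDr. Qed.

Lemma dotDl (u u' v : Ga) : dot (u + u') v = dot u v + dot u' v.
Proof. by rewrite /dot -big_split; apply: eq_bigr => i _; rewrite mxE mulrDl. Qed.

Lemma dotZr (h : R) (u v : Ga) : dot u (h *: v) = h * dot u v.
Proof. by rewrite /dot mulr_sumr; apply: eq_bigr => i _; rewrite mxE mulrCA. Qed.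

Lemma dotZl (h : R) (u v : Ga) : dot (h *: u) v = h * dot u v.
Proof. by rewrite /dot mulr_sumr; apply: eq_bigr => i _; rewrite mxE mulrA. Qed.

Lemma JaD U T : Ja (U + T) = Ja U + Ja T.
Proof. by rewrite /Ja !linearD /= add_row_mx. Qed.

Lemma JaZ (h : R) U : Ja (h *: U) = h *: Ja U.
Proof. by rewrite /Ja !linearZ /= scale_row_mx scalerN. Qed.

Lemma Ja0 : Ja 0 = 0.
Proof. by rewrite -(scale0r 0) JaZ !scale0r. Qed.

Lemma dot0l (u : Ga) : dot 0 u = 0.
Proof. by rewrite -(scale0r 0) dotZl mul0r. Qed.

Lemma dot0r (u : Ga) : dot u 0 = 0.
Proof. by rewrite -(scale0r 0) dotZr mul0r. Qed.

Lemma dot_Ja (U T : Ga) : dot (Ja U) T = - dot (Ja T) U.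
Proof.
rewrite /dot !big_split_ord /= opprD addrC -!sumrN.
by congr (_ + _); apply: eq_bigr => i _;
  rewrite /Ja ?row_mxEl ?row_mxEr !mxE ?mulNr ?opprK mulrC.
Qed.

Lemma gmul1g p : gmul gone p = p.
Proof.
rewrite gone_mk /gmul !mkK mul0r expR0 !mul1r !add0r scale1r.
by rewrite Ja0 dot0l mulr0 addr0 mk_eta.
Qed.

Lemma gmulVg p : gmul (ginv p) p = gone.
Proof.
rewrite gone_mk /gmul !mkK -scaleNr JaZ dotZl.
have -> : dot (Ja (cU p)) (cU p) = 0.
  by have /eqP := dot_Ja (cU p) (cU p); rewrite -addr_eq0 -mulr2n mulrn_eq0 => /eqP.
by rewrite !mulr0 addr0 !addNr scaleNr addNr.
Qed.

Lemma gmulA p q u : gmul p (gmul q u) = gmul (gmul p q) u.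
Proof.
rewrite /gmul !mkK mulrDl !expRD !scalerDr !scalerA !addrA; congr mk.
rewrite JaD JaZ dotDl dotDr !dotZl !dotZr.
have -> : expR (ca p) = expR (ca p / 2) * expR (ca p / 2).
  by rewrite -expRD -splitr.
ring.
Qed.

Lemma dL_mk p a U b :
  dL p (mk a U b) =
  mk a (expR (ca p / 2) *: U)
     (expR (ca p) * b + 2^-1 * expR (ca p / 2) * dot (Ja (cU p)) U).
Proof.
have near0 : \forall h \near 0^', h != 0 :> R by exact: nbhs_dnbhs_neq.
rewrite /dL /derive; apply: lim_near_cst => //.
near=> h; have h0 : h != 0 by near: h.
have -> : (gmul p \o shift gone) (h *: mk a U b) - gmul p gone =
    h *: mk a (expR (ca p / 2) *: U)
     (expR (ca p) * b + 2^-1 * expR (ca p / 2) * dot (Ja (cU p)) U).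
  rewrite /= {1}/gone addr0 gone_mk mkZ /gmul !mkK mkN mkD mkZ.
  rewrite dotZr dot0r scaler0 !mulr0 !addr0 !scalerA.
  rewrite -addrA.
  congr mk; first by rewrite addrC subrK.
    by rewrite addrAC subrr add0r mulrC.
  ring.
by rewrite scalerA mulVf // scale1r.
Unshelve. all: by end_near. Qed.

(* The Lie bracket at the identity of two left-invariant vector fields; [dL^~ Y]
   is the left-invariant field with value [Y] at the identity. *)
Definition bracket (X Y : V) : V := 'D_X (dL^~ Y) gone - 'D_Y (dL^~ X) gone.

Lemma derive_dL (a : R) (U : Ga) b c (T : Ga) d :
  'D_(mk a U b) (dL^~ (mk c T d)) gone =
  mk 0 ((a / 2) *: T) (a * d + 2^-1 * dot (Ja U) T).
Proof.
have df (x : R) : (fun h : R => h^-1 * (expR (h * x) - 1)) @ (0:R)^' --> x.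
  have D : is_derive (0 : R) (1 : R) (fun h : R => expR (h * x)) x.
    have D1 : is_derive (0 : R) (1 : R) (fun h : R => h * x) x.
      have -> : (fun h : R => h * x) = x \*: (@id R).
        by apply/funext => h /=; rewrite mulrC.
      rewrite -[X in is_derive _ _ _ X]mulr1; exact: is_deriveZ.
    have D2 := @is_derive1_comp R expR ( *%R^~ x) 0 _ _ (is_derive_expR _) D1.
    by move: D2; rewrite /= mul0r expR0 mul1r.
  case: D => D1 D2; rewrite -[X in _ --> X]D2.
  rewrite /derivable in D1; move: D1; rewrite /derive.
  set u := fun _ => _; set v := fun _ => _.
  have -> : v = u.
    apply/funext => h; rewrite /u /v /= mul0r expR0 addr0.
    by rewrite [h *: 1]mulr1.
  by [].
have dh : (fun h : R => h^-1 * h) @ (0:R)^' --> (1 : R).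
  apply: (@cvg_trans _ ((cst 1 : R -> R) @ (0:R)^')); last exact: cvg_cst.
  apply: near_eq_cvg; near=> h; rewrite mulVf //.
  by near: h; exact: nbhs_dnbhs_neq.
have de (x : R) : (fun h : R => expR (h * x)) @ (0:R)^' --> (1 : R).
  apply: cvg_within_filter.
  have C : continuous (expR \o ( *%R^~ x)).
    move=> y; apply: continuous_comp; first exact: mulrr_continuous.
    exact: continuous_expR.
  by have := C 0; rewrite /continuous_at /= mul0r expR0.
rewrite /derive.
set F := fun _ => _.
have -> : F = (fun h => (h^-1 * (expR (h * (a / 2)) - 1)) *: mk 0 T 0
        + (h^-1 * (expR (h * a) - 1) * d + h^-1 * h * expR (h * (a / 2)) * (2^-1 * dot (Ja U) T)) *: mk 0 0 1).
  apply/funext => h; rewrite /F /= {1}/gone addr0 gone_mk !mkZ !dL_mk !mkK.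
  rewrite mkN !mkD mkZ mul0r expR0 Ja0 dot0l JaZ dotZl !mulr0 !addr0 subrr mulr0.
  rewrite scale1r !mul1r mulr1 add0r scaler0 addr0.
  have -> : h * a / 2 = h * (a / 2) by rewrite mulrA.
  rewrite -{2}(scale1r T) -scalerBl scalerA; congr (mk 0 _ _).
  ring.
have -> : mk 0 ((a / 2) *: T) (a * d + 2^-1 * dot (Ja U) T)
  = (a / 2) *: mk 0 T 0 + (a * d + 1 * 1 * (2^-1 * dot (Ja U) T)) *: mk 0 0 1.
  by rewrite !mkZ mkD !mulr0 !mulr1 !mul1r scaler0 addr0 add0r addr0.
apply: cvg_lim => //.
apply: cvgD; apply: cvgZr_tmp; first exact: df.
apply: cvgD; first by apply: cvgMr_tmp; exact: df.
apply: cvgMr_tmp; apply: cvgM; [exact: dh|exact: de].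
Unshelve. all: by end_near. Qed.

Lemma bracket_mk (a : R) (U : Ga) b c (T : Ga) d :
  bracket (mk a U b) (mk c T d) =
  mk 0 ((a / 2) *: T - (c / 2) *: U) (a * d - c * b + dot (Ja U) T).
Proof.
have := f_equal2 (fun x y : V => x - y)
  (derive_dL a U b c T d) (derive_dL c T d a U b).
rewrite -/(bracket (mk a U b) (mk c T d)) => ->.
rewrite mkN mkD subr0 (dot_Ja T U).
by congr mk; field.
Qed.

Definition one_parameter (c : R -> V) (X : V) : Prop :=
  [/\ forall s t, c (s + t) = gmul (c s) (c t), derivable c 0 1
    & derive1 c 0 = X].

Definition Exp_image (s : set V) : set V :=
  [set p | exists X c, [/\ s X, one_parameter c X & c 1 = p]].

(* The connected Lie subgroup with Lie algebra [s] is generated by Exp(s). *)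
Definition connected_subgroup (s : set V) : set V :=
  [set p | exists l : seq V,
     (forall q, q \in l -> Exp_image s q) /\ p = foldr gmul gone l].

(* a + w + g_{2 alpha} *)
Definition s_alg (w : {vspace Ga}) : set V :=
  [set X | exists a U b, U \in w /\ X = a *: B + mk 0 U 0 + b *: Z].

(* The orbit S . o of the base point, which is the identity of AN. *)
Definition Worb (w : {vspace Ga}) : set V :=
  [set gmul p gone | p in connected_subgroup (s_alg w)].

End ComplexHyperbolic.

(* Main.v *)
From HB Require Import structures.
Require Import Defs.
From mathcomp Require Import all_boot all_order all_algebra.
From mathcomp Require Import all_classical all_reals all_analysis.
From mathcomp Require Import ring lra zify.
Set Implicit Arguments.
Unset Strict Implicit.
Unset Printing Implicit Defensive.
Import Order.TTheory GRing.Theory Num.Theory.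
Import numFieldNormedType.Exports.
Local Open Scope classical_set_scope.
Local Open Scope ring_scope.

(** In the coordinates [mk t P z] the metric is
    dt^2 + e^{-t} |dP|^2 + e^{-2t} (dz - <JP, dP> / 2)^2 and W is {P \in w}.
    Let Q be the orthogonal projection of P onto the complement of w.  A geodesic
    leaving W orthogonally is determined by first integrals: it stays in the
    translate of a real hyperbolic plane and traces there a half circle of the
    upper half-plane with height e^{t/2}.  Hence the tube of radius r is the cone
    |Q|^2 = 4 sinh^2(r/2) e^t, and its inward unit normal is the restriction of a
    field that is polynomial in the coordinates.

    Written in the left-invariant frame with q = e^{-t/2} Q, the shape operator
    preserves four mutually orthogonal pieces: it is (1/2) tanh(r/2) on B + q/2
    and on the part of w orthogonal to Jq, (1/2) coth(r/2) on the complement of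
    w orthogonal to q, and on the plane spanned by Jq and Z, which contains J of
    the normal, its characteristic polynomial has the roots lambda_1, lambda_2. *)

(** * Calculus on row vectors *)

(** [tube] and [inward_unit_normal] quantify over all curves that solve the geodesic equation. An
    explicit geodesic therefore yields only one inclusion between tube and cone; the first integrals
    yield the other. Those for [theta] and [cU] are the momenta of left translations along Z and
    along g_alpha.

    The half-plane carries dt^2 + e^{-t} dx^2, of curvature -1/4, hence the argument r/2 everywhere.
    On the half circle the abscissa |Q| and the height e^{t/2} both scale with the foot point, so
    their quotient 2 sinh(r/2) depends on r alone: the tube is a cone.

    A normal field is prescribed only on the tube, but its derivatives in tangent directions see
    nothing else, so one polynomial representative serves for every [eta].

    Total reality puts Jq into w, and [q, Jq] is a nonzero multiple of Z. This is what ties Jq to Z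
    in the shape operator and produces the two irrational curvatures. *)

Section LinearMaps.
Context {R : realType} {N : nat} {W : normedModType R}.
Notation V := 'rV[R]_N.

Lemma differentiable_linear_rV (f : V -> W) x : linear f -> differentiable f x.
Proof.
move=> fl.
pose f' : {linear V -> W} :=
  HB.pack f (GRing.isLinear.Build R V W *:%R f fl).
have -> : f = \sum_(j < N) (fun v : V => v 0 j *: f (delta_mx 0 j)).
  apply/funext => v; rewrite fct_sumE.
  rewrite {1}[v]row_sum_delta -[f]/(f' : V -> W) linear_sum.
  by apply: eq_bigr => j _; rewrite linearZ.
apply: differentiable_sum => j.
by apply: differentiableZl; exact: differentiable_coord.
Qed.

Lemma is_derive_linear_rV (f : V -> W) x v :
  linear f -> is_derive x v f (f v).
Proof.
move=> fl; have df y := differentiable_linear_rV y fl.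
pose f' : {linear V -> W} :=
  HB.pack f (GRing.isLinear.Build R V W *:%R f fl).
have fc : continuous f' by move=> y; exact: differentiable_continuous (df y).
apply: DeriveDef; first exact: diff_derivable.
by rewrite deriveE // -[f]/(f' : V -> W) diff_lin.
Qed.

(** The chain rule, mostly read backwards: a directional derivative of [f] is computed as a
    one-variable derivative along a line or along a curve in the tube. *)
Lemma is_derive_curve (f : V -> W) (c : R -> V) (s : R) (X : V) :
  differentiable f (c s) -> is_derive s (1 : R) c X ->
  is_derive s (1 : R) (f \o c) ('D_X f (c s)).
Proof.
move=> df [dc <-].
have dc' : differentiable c s by apply/derivable1_diffP.
have dfc : differentiable (f \o c) s by exact: differentiable_comp.
apply: DeriveDef; first exact: diff_derivable.
by rewrite !deriveE // diff_comp.
Qed.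

Lemma is_derive_linear_curve (f : V -> W) (c : R -> V) (s : R) (X : V) :
  linear f -> is_derive s (1 : R) c X -> is_derive s (1 : R) (f \o c) (f X).
Proof.
move=> fl dc; have [_ <-] := is_derive_linear_rV (c s) X fl.
by apply: is_derive_curve => //; exact: differentiable_linear_rV.
Qed.

End LinearMaps.

Section CurvesCalculus.
Context {R : realType}.

Lemma is_derive1E (W : normedModType R) (f : R -> W) (s : R) (X : W) :
  is_derive s (1 : R) f X <-> derivable f s 1 /\ derive1 f s = X.
Proof. by rewrite derive1E; split=> [[]|[? ?]]. Qed.

Lemma is_derive_0_cst_rV N (f : R -> 'rV[R]_N) x y :
  (forall s : R, is_derive s (1 : R) f 0) -> f x = f y.
Proof.
move=> df; apply/rowP => j.
pose h (v : 'rV[R]_N) : R := v 0 j.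
have hl : linear (h : 'rV[R]_N -> R^o) by move=> a u v; rewrite /h !mxE.
apply: (@is_derive_0_is_cst R (h \o f)) => s.
have := is_derive_linear_curve hl (df s).
by rewrite /h mxE.
Qed.

Lemma is_derive_scale (W : normedModType R) (f : R -> R) (v : W) (s df : R) :
  is_derive s (1 : R) f df -> is_derive s (1 : R) (fun x => f x *: v) (df *: v).
Proof.
move=> [fd <-].
have fd' : differentiable f s by apply/derivable1_diffP.
apply: DeriveDef; first exact/diff_derivable/differentiableZl.
rewrite deriveE; last exact: differentiableZl.
by rewrite (diffZl v fd') deriveE.
Qed.

End CurvesCalculus.

(** * Smoothness of exponential polynomials *)

Section Smooth.
Context {R : realType} {N : nat}.
Notation V := 'rV[R]_N.

Lemma smooth_on_class (W : normedModType R) (C : set (V -> W)) O f :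
  (forall h x, C h -> differentiable h x) ->
  (forall h v, C h -> C (fun x => 'D_v h x)) -> C f -> smooth_on O f.
Proof.
move=> dC DC Cf vs x _; apply: dC.
by elim: vs => //= v vs; exact: DC.
Qed.

(* Both classes consist of differentiable functions and are stable under every
   ['D_v], so that their members pass the test of [smooth_on]. *)
Inductive expoly : (V -> R) -> Prop :=
| expoly_cst a : expoly (cst a)
| expoly_linear f : linear (f : V -> R^o) -> expoly f
| expolyD f g : expoly f -> expoly g -> expoly (f + g)
| expolyM f g : expoly f -> expoly g -> expoly (f * g)
| expoly_exp f : linear (f : V -> R^o) -> expoly (fun x => expR (f x)).

Inductive expolyV (W : normedModType R) : (V -> W) -> Prop :=
| expolyV_cst a : expolyV (cst a)
| expolyV_linear f : linear f -> expolyV f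
| expolyVD f g : expolyV f -> expolyV g -> expolyV (f + g)
| expolyVZ f w : expoly f -> expolyV (fun x => f x *: w).

Lemma is_derive_expR_linear (f : V -> R) x v : linear (f : V -> R^o) ->
  differentiable (fun y => expR (f y)) x /\
  'D_v (fun y => expR (f y)) x = f v * expR (f x).
Proof.
move=> fl.
have df : differentiable (f : V -> R^o) x by exact: differentiable_linear_rV.
have de : differentiable (expR : R -> R) (f x).
  by apply/derivable1_diffP; exact: derivable_expR.
have dc : differentiable (expR \o f) x by exact: differentiable_comp.
split => //.
rewrite deriveE // diff_comp //=.
have [_ e] := is_derive_linear_rV x v fl.
rewrite -(deriveE _ df) e.
have -> : 'd (expR : R -> R) (f x) (f v) = 'D_(f v) (expR : R -> R) (f x).
  by rewrite deriveE.
rewrite -[f v]mulr1 deriveE // linearZ -deriveE //=.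
by have [_ ->] := is_derive_expR (f x); rewrite mulr1.
Qed.

Lemma expoly_derive f : expoly f ->
  (forall x, differentiable f x) /\ (forall v, expoly (fun x => 'D_v f x)).
Proof.
elim=> {f} [a|f fl|f g _ [df Df] _ [dg Dg]|f g Ef [df Df] Eg [dg Dg]|f fl].
- split=> // v; rewrite (_ : (fun _ => _) = cst 0); first exact: expoly_cst.
  by apply/funext => x; rewrite derive_cst.
- split=> [x|v]; first exact: (@differentiable_linear_rV _ _ R^o).
  rewrite (_ : (fun _ => _) = cst (f v)); first exact: expoly_cst.
  by apply/funext => x; have [_ ->] := is_derive_linear_rV x v fl.
- split=> [x|v]; first exact: differentiableD.
  rewrite (_ : (fun _ => _) = (fun x => 'D_v f x) + (fun x => 'D_v g x)).
    exact: expolyD.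
  by apply/funext => x; rewrite deriveD //; exact: diff_derivable.
- split=> [x|v]; first exact: differentiableM.
  rewrite (_ : (fun _ => _) =
    f * (fun x => 'D_v g x) + g * (fun x => 'D_v f x)).
    by apply: expolyD; apply: expolyM.
  by apply/funext => x; rewrite deriveM //; exact: diff_derivable.
- split=> [x|v]; first by have [] := is_derive_expR_linear x 0 fl.
  rewrite (_ : (fun _ => _) = cst (f v) * (fun x => expR (f x))).
    by apply: expolyM; [exact: expoly_cst|exact: expoly_exp].
  by apply/funext => x; have [_ ->] := is_derive_expR_linear x v fl.
Qed.

Lemma expoly_smooth O f : expoly f -> smooth_on O f.
Proof.
apply: (@smooth_on_class R expoly) => h.
  by move=> x /expoly_derive[].
by move=> v /expoly_derive[].
Qed.

Lemma expolyV_derive (W : normedModType R) (f : V -> W) : expolyV f ->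
  (forall x, differentiable f x) /\ (forall v, expolyV (fun x => 'D_v f x)).
Proof.
elim=> {f} [a|f fl|f g _ [df Df] _ [dg Dg]|f w /expoly_derive[df Df]].
- split=> // v; rewrite (_ : (fun _ => _) = cst 0); first exact: expolyV_cst.
  by apply/funext => x; rewrite derive_cst.
- split=> [x|v]; first exact: differentiable_linear_rV.
  rewrite (_ : (fun _ => _) = cst (f v)); first exact: expolyV_cst.
  by apply/funext => x; have [_ ->] := is_derive_linear_rV x v fl.
- split=> [x|v]; first exact: differentiableD.
  rewrite (_ : (fun _ => _) = (fun x => 'D_v f x) + (fun x => 'D_v g x)).
    exact: expolyVD.
  by apply/funext => x; rewrite deriveD //; exact: diff_derivable.
- split=> [x|v]; first exact: differentiableZl.
  rewrite (_ : (fun _ => _) = (fun x => 'D_v f x *: w)).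
    exact: (expolyVZ _ (Df v)).
  apply/funext => x; rewrite deriveE; last exact: differentiableZl.
  by rewrite (diffZl w (df x)) deriveE.
Qed.

Lemma expolyV_smooth (W : normedModType R) O (f : V -> W) :
  expolyV f -> smooth_on O f.
Proof.
apply: (@smooth_on_class W (@expolyV W)) => h.
  by move=> x /expolyV_derive[].
by move=> v /expolyV_derive[].
Qed.

End Smooth.

(** * Koszul's formula for the coordinate Christoffel symbols *)

Section Koszul.
Context {R : realType} {N : nat}.
Notation V := 'rV[R]_N.
Notation e i := (delta_mx 0 i : V).

Lemma linear_rV_sum (f : V -> R) (X : V) : linear (f : V -> R^o) ->
  f X = \sum_i X 0 i * f (e i).
Proof.
move=> fl.
pose f' : {linear V -> R^o} :=
  HB.pack f (GRing.isLinear.Build R V R^o *:%R f fl).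
rewrite {1}[X]row_sum_delta -[f]/(f' : V -> R) linear_sum.
by apply: eq_bigr => j _; rewrite linearZ.
Qed.

(* [D X Y T] is the derivative at [p] of [g _ Y T] in the direction [X]. *)
Variables (g : V -> V -> V -> R) (p : V) (D : V -> V -> V -> R).
Hypothesis gC : forall X Y, g p X Y = g p Y X.
Hypothesis gl : forall X, linear (g p X : V -> R^o).
Hypothesis g_gt0 : forall X, X != 0 -> 0 < g p X X.
Hypothesis Dl1 : forall Y T, linear (fun X => D X Y T : R^o).
Hypothesis Dl2 : forall X T, linear (fun Y => D X Y T : R^o).
Hypothesis Dl3 : forall X Y, linear (fun T => D X Y T : R^o).
Hypothesis gD : forall X Y T, 'D_X (fun q => g q Y T) p = D X Y T.

Lemma metric_gram X Y : g p X Y = (X *m gram g p *m Y^T) 0 0.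
Proof.
rewrite (linear_rV_sum Y (gl X)) mxE; apply: eq_bigr => j _.
rewrite gC (linear_rV_sum X (gl (e j))) mulrC mxE mxE; congr (_ * _).
by apply: eq_bigr => i _; rewrite mxE gC.
Qed.

Lemma gram_sym : (gram g p)^T = gram g p.
Proof. by apply/matrixP => i j; rewrite !mxE gC. Qed.

Lemma gram_unit : gram g p \in unitmx.
Proof.
rewrite -row_free_unit; apply: inj_row_free => v v0.
apply/eqP; apply/negPn/negP => /g_gt0.
by rewrite metric_gram v0 mul0mx mxE ltxx.
Qed.

(** Coordinate fields commute, so only the derivatives of the metric occur. Pairing with [T] cancels
    the inverse Gram matrix, and no Christoffel symbol has to be computed. *)
Lemma koszul X Y T :
  g p (Gamma g p X Y) T = 2^-1 * (D X Y T + D Y X T - D T X Y).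
Proof.
have DE A C F : D A C F = \sum_h \sum_i \sum_j
    A 0 i * C 0 j * F 0 h * dgram g i j h p.
  rewrite (linear_rV_sum F (Dl3 A C)); apply: eq_bigr => h _.
  rewrite (linear_rV_sum A (Dl1 C (e h))) mulr_sumr; apply: eq_bigr => i _.
  rewrite (linear_rV_sum C (Dl2 (e i) (e h))) mulr_sumr mulr_sumr.
  apply: eq_bigr => j _; rewrite -gD /dgram.
  have -> : (fun q => gram g q j h) = (fun q => g q (e j) (e h)).
    by apply/funext => q; rewrite mxE.
  ring.
(* The Christoffel symbols of the first kind contracted with [X] and [Y]; raising the index gives
   [Gamma]. *)
pose S : V := \row_h (\sum_i \sum_j X 0 i * Y 0 j *
  (2^-1 * (dgram g i j h p + dgram g j i h p - dgram g h i j p))).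
have -> : Gamma g p X Y = S *m invmx (gram g p).
  apply/rowP => l; rewrite [LHS]mxE [RHS]mxE.
  under eq_bigr => i _.
    under eq_bigr => j _.
      rewrite /christoffel mulr_sumr !mulr_suml.
      over.
    rewrite exchange_big /=.
    over.
  rewrite exchange_big /=; apply: eq_bigr => h _.
  rewrite mxE mulr_suml; apply: eq_bigr => i _.
  rewrite mulr_suml; apply: eq_bigr => j _.
  have -> : invmx (gram g p) h l = invmx (gram g p) l h.
    by rewrite -[in RHS]gram_sym -trmx_inv mxE.
  ring.
rewrite metric_gram mulmxKV; last exact: gram_unit.
rewrite !DE mxE.
have -> : \sum_h \sum_i \sum_j Y 0 i * X 0 j * T 0 h * dgram g i j h p =
  \sum_h \sum_i \sum_j X 0 i * Y 0 j * T 0 h * dgram g j i h p.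
  apply: eq_bigr => h _; rewrite exchange_big /=.
  by apply: eq_bigr => i _; apply: eq_bigr => j _; ring.
have -> : \sum_h \sum_i \sum_j T 0 i * X 0 j * Y 0 h * dgram g i j h p =
  \sum_h \sum_i \sum_j X 0 i * Y 0 j * T 0 h * dgram g h i j p.
  rewrite exchange_big /=.
  apply: eq_bigr => h _; rewrite exchange_big /=.
  apply: eq_bigr => i _.
  by apply: eq_bigr => j _; ring.
rewrite -big_split -sumrB mulr_sumr; apply: eq_bigr => h _.
rewrite mxE mxE -big_split -sumrB mulr_sumr mulr_suml; apply: eq_bigr => i _.
rewrite -big_split -sumrB mulr_sumr mulr_suml; apply: eq_bigr => j _.
set a := dgram _ _ _ _ _; set b := dgram _ _ _ _ _; set c := dgram _ _ _ _ _.
by rewrite /GRing.add_fun /=; ring.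
Qed.

End Koszul.

(** * The group AN and its Levi-Civita connection *)

Section AN.
Context {R : realType} {m : nat}.
Notation Ga := 'rV[R]_(m + m).
Notation V := 'rV[R]_(1 + (m + m) + 1).
Implicit Types (p q X Y T : V) (U : Ga).

Lemma dotC U (U' : Ga) : dot U U' = dot U' U.
Proof. by apply: eq_bigr => i _; rewrite mulrC. Qed.

Lemma dotNl U (U' : Ga) : dot (- U) U' = - dot U U'.
Proof. by rewrite -scaleN1r dotZl mulN1r. Qed.

Lemma dotNr U (U' : Ga) : dot U (- U') = - dot U U'.
Proof. by rewrite dotC dotNl dotC. Qed.

Lemma dotBr (U1 U2 U : Ga) : dot U (U1 - U2) = dot U U1 - dot U U2.
Proof. by rewrite dotDr dotNr. Qed.

Lemma dot_ge0 U : 0 <= dot U U.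
Proof. by apply: sumr_ge0 => i _; rewrite -expr2 sqr_ge0. Qed.

Lemma dot_eq0 U : (dot U U == 0) = (U == 0).
Proof.
apply/eqP/eqP => [|->]; last by rewrite dot0l.
move/eqP; rewrite psumr_eq0 => [/allP h|i _]; last by rewrite -expr2 sqr_ge0.
apply/rowP => i; rewrite mxE; apply/eqP.
by have := h i (mem_index_enum _); rewrite -expr2 sqrf_eq0.
Qed.

Lemma dot_gt0 U : (0 < dot U U) = (U != 0).
Proof. by rewrite lt0r dot_ge0 andbT dot_eq0. Qed.

Lemma dot_Ja_self U : dot (Ja U) U = 0.
Proof.
by have /eqP := dot_Ja U U; rewrite -addr_eq0 -mulr2n mulrn_eq0 => /eqP.
Qed.

Lemma JaK U : Ja (Ja U) = - U.
Proof. by rewrite /Ja row_mxKl row_mxKr -opp_row_mx -[U in RHS]hsubmxK opp_row_mx. Qed.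

Lemma dot_JaJa U (U' : Ga) : dot (Ja U) (Ja U') = dot U U'.
Proof. by rewrite dot_Ja JaK dotNl opprK dotC. Qed.

Lemma JaN U : Ja (- U) = - Ja U.
Proof. by rewrite -scaleN1r JaZ scaleN1r. Qed.

Lemma caD X Y : ca (X + Y) = ca X + ca Y.
Proof. by rewrite /ca !linearD /= mxE. Qed.
Lemma caZ a X : ca (a *: X) = a * ca X.
Proof. by rewrite /ca !linearZ /= mxE. Qed.
Lemma cUD X Y : cU (X + Y) = cU X + cU Y.
Proof. by rewrite /cU !linearD. Qed.
Lemma cUZ a X : cU (a *: X) = a *: cU X.
Proof. by rewrite /cU !linearZ. Qed.
Lemma czD X Y : cz (X + Y) = cz X + cz Y.
Proof. by rewrite /cz !linearD /= mxE. Qed.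
Lemma czZ a X : cz (a *: X) = a * cz X.
Proof. by rewrite /cz !linearZ /= mxE. Qed.

Definition coordE :=
  (@ca_mk R m, @cU_mk R m, @cz_mk R m, caD, caZ, cUD, cUZ, czD, czZ).

Definition dotE :=
  (@dotDl R m, @dotDr R m, dotNl, dotNr, @dotZl R m, @dotZr R m, @dot0l R m,
   @dot0r R m).

Lemma mk_inj a (U U' : Ga) b a' b' :
  mk a U b = mk a' U' b' -> [/\ a = a', U = U' & b = b'].
Proof.
by move=> e; split;
  [rewrite -(ca_mk a U b)|rewrite -(cU_mk a U b)|rewrite -(cz_mk a U b)];
  rewrite e mkK.
Qed.

Lemma linear_ca : linear (@ca R m : V -> R^o).
Proof. by move=> a X Y; rewrite !coordE. Qed.
Lemma linear_cU : linear (@cU R m).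
Proof. by move=> a X Y; rewrite !coordE. Qed.
Lemma linear_cz : linear (@cz R m : V -> R^o).
Proof. by move=> a X Y; rewrite !coordE. Qed.

Definition vdot X Y := ca X * ca Y + dot (cU X) (cU Y) + cz X * cz Y.

Lemma dot_mk X Y : dot X Y = vdot X Y.
Proof.
rewrite /vdot /dot !big_split_ord /= !big_ord1 /ca /cU /cz !mxE.
by congr (_ + (_ + _) + _); apply: eq_bigr => i _; rewrite !mxE.
Qed.

(* The value at [X] of the left-invariant 1-form dual to [Z] is
   [expR (- ca p) * theta p X]. *)
Definition theta p X : R := cz X - 2^-1 * dot (Ja (cU p)) (cU X).

Lemma thetaD p X Y : theta p (X + Y) = theta p X + theta p Y.
Proof. by rewrite /theta !coordE dotDr; ring. Qed.

Lemma thetaZ p a X : theta p (a *: X) = a * theta p X.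
Proof. by rewrite /theta !coordE dotZr; ring. Qed.

Lemma expR_half (x : R) : expR (x / 2) * expR (x / 2) = expR x.
Proof. by rewrite -expRD -splitr. Qed.

(** A left translation is affine in these coordinates, so its differential is its linear part
    [f]. *)
Lemma dLinvE p X : dLinv p X =
  mk (ca X) (expR (- ca p / 2) *: cU X) (expR (- ca p) * theta p X).
Proof.
rewrite /dLinv.
pose f q : V := mk (ca q) (expR (- ca p / 2) *: cU q) (expR (- ca p) * theta p q).
have fl : linear f.
  move=> a u v; rewrite /f thetaD thetaZ !coordE mkZ mkD scalerDr !scalerA.
  by congr mk; [congr (_ *: _ + _); ring|ring].
have -> : gmul (ginv p) = cst (ginv p) + f.
  apply/funext => q; rewrite /gmul /f /= -[ginv p in RHS]mk_eta.
  rewrite [RHS]mkD !mkK JaN JaZ /theta dotNl dotZl -(expR_half (- ca p)).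
  by congr mk; ring.
have df := is_derive_linear_rV p X fl.
have := is_deriveD (is_derive_cst (ginv p) p X) df.
by case=> _ ->; rewrite add0r.
Qed.

Lemma dLE p X : dL p X =
  mk (ca X) (expR (ca p / 2) *: cU X)
     (expR (ca p) * cz X + 2^-1 * expR (ca p / 2) * dot (Ja (cU p)) (cU X)).
Proof. by rewrite -[X in LHS]mk_eta dL_mk. Qed.

Local Opaque dL dLinv.

Lemma expR_mulN (x : R) : expR x * expR (- x) = 1.
Proof. by rewrite -expRD subrr expR0. Qed.

Lemma expR_Nmul (x : R) : expR (- x) * expR x = 1.
Proof. by rewrite mulrC expR_mulN. Qed.

Lemma expR_halfN (x : R) : expR (x / 2) * expR (- x / 2) = 1.
Proof. by rewrite -expRD -mulrDl subrr mul0r expR0. Qed.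

Lemma dLK p : cancel (dL p) (dLinv p).
Proof.
move=> X; rewrite dLinvE dLE /theta !mkK scalerA mulrC expR_halfN scale1r.
rewrite dotZr -[RHS]mk_eta; congr mk.
transitivity (expR (- ca p) * expR (ca p) * cz X); first by ring.
by rewrite expR_Nmul mul1r.
Qed.

Lemma dLVK p : cancel (dLinv p) (dL p).
Proof.
move=> X; rewrite dLinvE dLE !mkK scalerA expR_halfN scale1r.
rewrite mulrA expR_mulN mul1r dotZr /theta -[RHS]mk_eta; congr mk.
transitivity (cz X + 2^-1 * (expR (ca p / 2) * expR (- ca p / 2) - 1) *
   dot (Ja (cU p)) (cU X)); first by ring.
by rewrite expR_halfN subrr mulr0 mul0r addr0.
Qed.

Lemma dLinvD p X Y : dLinv p (X + Y) = dLinv p X + dLinv p Y.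
Proof.
by rewrite !dLinvE mkD thetaD !coordE scalerDr mulrDr.
Qed.

Lemma dLinvZ p a X : dLinv p (a *: X) = a *: dLinv p X.
Proof.
rewrite !dLinvE mkZ thetaZ !coordE !scalerA.
by congr mk; [congr (_ *: _); rewrite mulrC|ring].
Qed.

Lemma dLinvN p X : dLinv p (- X) = - dLinv p X.
Proof. by rewrite -scaleN1r dLinvZ scaleN1r. Qed.

Lemma dLinvB p X Y : dLinv p (X - Y) = dLinv p X - dLinv p Y.
Proof. by rewrite dLinvD dLinvN. Qed.

Lemma linear_dLinv p : linear (dLinv p).
Proof. by move=> a X Y; rewrite dLinvD dLinvZ. Qed.

Lemma linear_dL p : linear (dL p).
Proof.
pose f : {linear V -> V} :=
  HB.pack (dLinv p) (GRing.isLinear.Build R V V *:%R (dLinv p) (linear_dLinv p)).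
exact: (@can2_linear _ _ _ f _ (dLVK p) (dLK p)).
Qed.

Lemma vdotC X Y : vdot X Y = vdot Y X.
Proof. by rewrite /vdot dotC; ring. Qed.

Lemma vdotDr X Y T : vdot X (Y + T) = vdot X Y + vdot X T.
Proof. by rewrite /vdot !coordE dotDr; ring. Qed.

Lemma vdotZr a X Y : vdot X (a *: Y) = a * vdot X Y.
Proof. by rewrite /vdot !coordE dotZr; ring. Qed.

Lemma vdotNr X Y : vdot X (- Y) = - vdot X Y.
Proof. by rewrite -scaleN1r vdotZr mulN1r. Qed.

Lemma vdotDl X Y T : vdot (Y + T) X = vdot Y X + vdot T X.
Proof. by rewrite vdotC vdotDr !(vdotC X). Qed.

Lemma vdotNl X Y : vdot (- X) Y = - vdot X Y.
Proof. by rewrite vdotC vdotNr vdotC. Qed.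

Lemma vdotZl a X Y : vdot (a *: X) Y = a * vdot X Y.
Proof. by rewrite vdotC vdotZr vdotC. Qed.

Lemma vdot_gt0 X : X != 0 -> 0 < vdot X X.
Proof.
move=> X0; rewrite lt0r; apply/andP; split; last first.
  by rewrite /vdot !addr_ge0 ?dot_ge0 // -expr2 sqr_ge0.
apply: contra X0; rewrite /vdot -!expr2.
rewrite paddr_eq0 ?addr_ge0 ?sqr_ge0 ?dot_ge0 //.
rewrite paddr_eq0 ?sqr_ge0 ?dot_ge0 // !sqrf_eq0 dot_eq0.
case/andP=> /andP[/eqP a0 /eqP U0] /eqP b0.
by rewrite -[X]mk_eta a0 U0 b0 -gone_mk.
Qed.

Lemma vdot_inj X Y : (forall T, vdot X T = vdot Y T) -> X = Y.
Proof.
move=> h; apply/eqP; rewrite -subr_eq0; apply/negPn/negP => /vdot_gt0.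
by rewrite vdotDl vdotNl h subrr ltxx.
Qed.

Lemma gCHE p X Y : gCH p X Y = vdot (dLinv p X) (dLinv p Y).
Proof. exact: dot_mk. Qed.

Lemma gCH_theta p X Y : gCH p X Y = ca X * ca Y +
  expR (- ca p) * dot (cU X) (cU Y) +
  expR (- ca p) * expR (- ca p) * (theta p X * theta p Y).
Proof.
rewrite gCHE /vdot !dLinvE !mkK dotZl dotZr -(expR_half (- ca p)).
by ring.
Qed.

End AN.

(** * The Levi-Civita connection in the left-invariant frame *)

Section Connection.
Context {R : realType} {m : nat}.
Notation Ga := 'rV[R]_(m + m).
Notation V := 'rV[R]_(1 + (m + m) + 1).
Implicit Types (p q X Y T : V) (U : Ga).
Local Opaque dL dLinv gCH.

Lemma is_derive_gCH p X Y T : is_derive p X (fun q => gCH q Y T)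
 (- ca X * (expR (- ca p) * dot (cU Y) (cU T)) -
  (2 * ca X) * (expR (- ca p) * expR (- ca p) * (theta p Y * theta p T)) -
  expR (- ca p) * expR (- ca p) *
   (2^-1 * (dot (Ja (cU X)) (cU Y) * theta p T +
    theta p Y * dot (Ja (cU X)) (cU T)))).
Proof.
have dt A : is_derive p X (fun q => theta q A) (- 2^-1 * dot (Ja (cU X)) (cU A)).
  have l : linear ((fun q => - 2^-1 * dot (Ja (cU q)) (cU A)) : V -> R^o).
    by move=> a u v; rewrite !coordE JaD JaZ dotDl dotZl mulrDr mulrCA.
  have := is_deriveD (is_derive_cst (cz A : R^o) p X) (is_derive_linear_rV p X l).
  rewrite add0r; congr is_derive; apply/funext => q.
  by rewrite /theta -mulNr.
have de : is_derive p X (fun q : V => expR (- ca q)) (- ca X * expR (- ca p)).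
  have l : linear ((fun q => - ca q) : V -> R^o).
    by move=> a u v; rewrite !coordE opprD -mulrN.
  by have [d <-] := is_derive_expR_linear p X l; exact/derivableP/diff_derivable.
have -> : (fun q => gCH q Y T) = cst (ca Y * ca T) +
   ((fun q => expR (- ca q)) * cst (dot (cU Y) (cU T))) +
   ((fun q => expR (- ca q)) * (fun q => expR (- ca q)) *
      ((fun q => theta q Y) * (fun q => theta q T))).
  by apply/funext => q; rewrite gCH_theta.
have := is_deriveD (is_deriveD (is_derive_cst (ca Y * ca T : R^o) p X)
  (is_deriveM de (is_derive_cst (dot (cU Y) (cU T) : R^o) p X)))
  (is_deriveM (is_deriveM de de) (is_deriveM (dt Y) (dt T))).
congr is_derive.
rewrite !fctE /GRing.scale /=.
by ring.
Qed.

(* The Christoffel form of the coordinate fields, seen in the left-invariant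
   frame.  It is symmetric, unlike the connection form of the left-invariant
   fields, because coordinate fields commute. *)
Lemma dL0 p : dL p 0 = 0.
Proof.
have := linear_dL p (-1) 0 0; rewrite scaler0 addr0 scaleN1r => e.
by rewrite {1}e addNr.
Qed.

Definition Ghat X Y : V :=
  mk (2^-1 * dot (cU X) (cU Y) + cz X * cz Y)
     (- 2^-1 *: (ca X *: cU Y + ca Y *: cU X + cz Y *: Ja (cU X) + cz X *: Ja (cU Y)))
     (- (ca X * cz Y + ca Y * cz X)).

(** Left translations are affine, hence map constant vector fields to constant ones. Read in the
    left-invariant frame, the derivative of the metric on such fields is thus a trilinear form [D]
    independent of [p], and Koszul's formula turns it into [Ghat]. *)
Lemma dLinv_Gamma p X Y :
  dLinv p (Gamma gCH p X Y) = Ghat (dLinv p X) (dLinv p Y).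
Proof.
pose D X Y T := - ca X * dot (cU Y) (cU T) -
  (2 * ca X) * (cz Y * cz T) -
   (2^-1 * (dot (Ja (cU X)) (cU Y) * cz T +
    cz Y * dot (Ja (cU X)) (cU T))).
pose D' X Y T := D (dLinv p X) (dLinv p Y) (dLinv p T).
have gD A C F : 'D_A (fun q => gCH q C F) p = D' A C F.
  have [_ ->] := is_derive_gCH p A C F.
  rewrite /D' /D !dLinvE !mkK !JaZ !dotZl !dotZr -(expR_half (- ca p)).
  by ring.
apply: vdot_inj => T'.
have [T ->] : exists T, T' = dLinv p T by exists (dL p T'); rewrite dLK.
apply: etrans (etrans (esym (gCHE p _ _)) (@koszul _ _ gCH p D' _ _ _ _ _ _ gD X Y T)) _.
- by move=> A C; rewrite !gCHE; exact: vdotC.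
- by move=> A a u v; rewrite !gCHE linear_dLinv vdotDr vdotZr.
- move=> A A0; rewrite gCHE vdot_gt0 //; apply: contra A0 => /eqP e.
  apply/eqP; rewrite -[A](dLVK p) e.
  exact: dL0.
- move=> C F a u v; rewrite /D' linear_dLinv.
  move: (dLinv p C) (dLinv p F) (dLinv p u) (dLinv p v) => c f u' v'.
  by rewrite /D !coordE JaD JaZ !dotE /GRing.scale /=; ring.
- move=> A F a u v; rewrite /D' linear_dLinv.
  move: (dLinv p A) (dLinv p F) (dLinv p u) (dLinv p v) => c f u' v'.
  by rewrite /D !coordE !dotE /GRing.scale /=; ring.
- move=> A C a u v; rewrite /D' linear_dLinv.
  move: (dLinv p A) (dLinv p C) (dLinv p u) (dLinv p v) => c f u' v'.
  by rewrite /D !coordE !dotE /GRing.scale /=; ring.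
- rewrite /D' /D.
  move: (dLinv p X) (dLinv p Y) (dLinv p T) => x y t.
  rewrite /vdot /Ghat !mkK dotZl !dotDl !dotZl.
  rewrite (dot_Ja (cU y) (cU x)) (dot_Ja (cU t) (cU x)) (dot_Ja (cU t) (cU y)).
  by field.
Qed.

End Connection.

(** * Orthogonal projections, hyperbolic functions *)

Section Projection.
Context {R : realType} {m : nat}.
Notation Ga := 'rV[R]_(m + m).
Variable w : {vspace Ga}.
Implicit Types (u v : Ga).

Definition basis_dot v : 'rV[R]_(\dim w) := \row_i dot v (vbasis w)`_i.

Fact basis_dot_linear : linear basis_dot.
Proof. by move=> a u v; apply/rowP => i; rewrite !mxE dotDl dotZl. Qed.
HB.instance Definition _ :=
  GRing.isLinear.Build R Ga 'rV[R]_(\dim w) *:%R basis_dot basis_dot_linear.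

(** The set [orthc w] as a vector space, so that it has a dimension and a projection. *)
Definition orthcv : {vspace Ga} := lker (linfun basis_dot).

Lemma orthcvP v : reflect (orthc w v) (v \in orthcv).
Proof.
rewrite memv_ker lfunE /=; apply: (iffP eqP) => [/rowP v0 u uw|vw].
  rewrite (coord_vbasis uw).
  elim/big_ind: _ => [|x y hx hy|i _]; first exact: dot0r.
    by rewrite dotDr hx hy addr0.
  by have := v0 i; rewrite !mxE dotZr => ->; rewrite mulr0.
apply/rowP => i; rewrite !mxE; apply: vw.
by rewrite vbasis_mem // mem_nth // size_tuple.
Qed.

Lemma dot_orthcv u v : u \in orthcv -> v \in w -> dot u v = 0.
Proof. by move/orthcvP; apply. Qed.

Lemma capv_orthcv : (orthcv :&: w = 0)%VS.
Proof.
apply/eqP; rewrite -subv0; apply/subvP => v /memv_capP[vo vw].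
by rewrite memv0 -dot_eq0 dot_orthcv.
Qed.

(** A dimension count: the sum is direct, and the kernel of [basis_dot] has codimension at most
    [\dim w]. *)
Lemma addv_orthcv : (orthcv + w = fullv)%VS.
Proof.
apply/eqP; rewrite eqEdim subvf dimv_disjoint_sum ?capv_orthcv //=.
rewrite -(limg_ker_dim (linfun basis_dot) fullv) capfv leq_add2l.
by rewrite (leq_trans (dimvS (subvf _))) // dimvf /dim /= mul1n.
Qed.

Lemma dim_orthcv : (\dim orthcv + \dim w = m + m)%N.
Proof.
rewrite -dimv_disjoint_sum ?capv_orthcv // addv_orthcv dimvf.
by rewrite /dim /= mul1n.
Qed.

Definition oproj : Ga -> Ga := daddv_pi orthcv w.

Lemma linear_oproj : linear oproj.
Proof. by move=> a u v; rewrite /oproj linearP. Qed.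
HB.instance Definition _ := GRing.isLinear.Build R Ga Ga *:%R oproj linear_oproj.

Lemma oprojD u v : oproj (u + v) = oproj u + oproj v.
Proof. exact: linearD. Qed.

Lemma oprojZ a v : oproj (a *: v) = a *: oproj v.
Proof. exact: linearZ. Qed.

Lemma oproj_mem v : oproj v \in orthcv.
Proof. exact: memv_pi. Qed.

Lemma oproj_sub v : v - oproj v \in w.
Proof.
have vf : v \in (orthcv + w)%VS by rewrite addv_orthcv memvf.
rewrite -[X in X - _](daddv_pi_add capv_orthcv vf) addrAC subrr add0r.
exact: memv_pi.
Qed.

Lemma oproj_id v : v \in orthcv -> oproj v = v.
Proof. by move=> vo; rewrite /oproj daddv_pi_id // capv_orthcv. Qed.

Lemma oprojK v : oproj (oproj v) = oproj v.
Proof. by rewrite oproj_id // oproj_mem. Qed.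

Lemma dot_oproj u v : u \in orthcv -> dot u (oproj v) = dot u v.
Proof.
move=> uo; apply/eqP; rewrite eq_sym -subr_eq0 -dotBr.
by rewrite dot_orthcv // oproj_sub.
Qed.

Lemma oproj_eq0 v : (oproj v == 0) = (v \in w).
Proof.
apply/eqP/idP => [v0|vw]; first by have := oproj_sub v; rewrite v0 subr0.
apply/eqP; rewrite -dot_eq0 dot_oproj ?oproj_mem //.
by rewrite dot_orthcv // oproj_mem.
Qed.

Lemma orth_proj_oproj v : orth_proj dot (orthc w) v (oproj v).
Proof.
split; first exact/orthcvP/oproj_mem.
by move=> z /orthcvP zo; rewrite dotC dotBr dot_oproj // subrr.
Qed.

Lemma has_dim_orthcv k : has_dim (orthc w) k -> \dim orthcv = k.
Proof.
move=> [E [oE <-]]; congr (\dim _); apply/vspaceP => v.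
by apply/orthcvP/idP; rewrite oE.
Qed.

Lemma totally_real_oproj v :
  constant_kahler_angle (orthc w) (pi / 2) -> v \in orthcv -> oproj (Ja v) = 0.
Proof.
move=> tr vo; have [->|v0] := eqVneq v 0; first by rewrite Ja0 linear0.
have := tr v _ (elimT (orthcvP _) vo) v0 (orth_proj_oproj (Ja v)).
rewrite cos_pihalf mul0r => /eqP; rewrite sqrtr_eq0 => le0.
by apply/eqP; rewrite -dot_eq0 eq_le le0 dot_ge0.
Qed.

End Projection.

Section Hyperbolic.
Context {R : realType}.
Implicit Types x s : R.

Definition cosh x : R := (expR x + expR (- x)) / 2.
Definition sinh x : R := (expR x - expR (- x)) / 2.

Lemma cosh_gt0 x : 0 < cosh x.
Proof. by rewrite /cosh divr_gt0 // addr_gt0 ?expR_gt0. Qed.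

Lemma cosh_neq0 x : cosh x != 0.
Proof. by rewrite gt_eqF // cosh_gt0. Qed.

Lemma sinh_gt0 x : 0 < x -> 0 < sinh x.
Proof. by move=> x0; rewrite /sinh divr_gt0 // subr_gt0 ltr_expR; lra. Qed.

Lemma tanhE x : tanh x = sinh x / cosh x.
Proof.
have := cosh_neq0 x; rewrite /tanh /sinh /cosh mulf_eq0 invr_eq0.
by rewrite pnatr_eq0 orbF => h; field; rewrite h.
Qed.

Lemma cothE x : coth x = cosh x / sinh x.
Proof.
(* When the difference vanishes both quotients are 0, because the inverse of 0 is 0. *)
rewrite /coth /sinh /cosh; have [->|h] := eqVneq (expR x - expR (- x)) 0.
  by rewrite mul0r !invr0 !mulr0.
by field; rewrite h.
Qed.

Lemma cosh2_sinh2 x : cosh x ^+ 2 = sinh x ^+ 2 + 1.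
Proof.
transitivity (sinh x ^+ 2 + expR x * expR (- x)); last by rewrite expR_mulN.
by rewrite /cosh /sinh; field.
Qed.

Lemma cosh0 : cosh 0 = 1.
Proof. by rewrite /cosh oppr0 expR0; field. Qed.

Lemma sinh0 : sinh 0 = 0.
Proof. by rewrite /sinh oppr0 subrr mul0r. Qed.

Lemma tanh0 : tanh (0 : R) = 0.
Proof. by rewrite tanhE sinh0 mul0r. Qed.

(** Solves a first integral of the form produced in [cU'], where [y] is the initial value of the
    exponent variable [x]. *)
Lemma expR_quotient (a b x y : R) :
  a * expR (- 1 * x + y) = b * expR (- 1 * y + y) -> a = expR (x - y) * b.
Proof.
rewrite !mulN1r addNr expR0 mulr1 => <-.
have e : x - y + (- x + y) = 0 by ring.
by rewrite mulrCA -expRD e expR0 mulr1.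
Qed.

Lemma is_derive_affine (a b s : R) : is_derive s (1 : R) (fun x => a * x + b) a.
Proof.
have := is_deriveD (is_deriveZ a (is_derive_id s (1 : R)))
  (is_derive_cst (b : R^o) s (1 : R)).
by rewrite addr0 [a *: 1]mulr1; congr is_derive; apply/funext.
Qed.

Lemma is_derive_expR_affine (a b s : R) :
  is_derive s (1 : R) (fun x => expR (a * x + b)) (a * expR (a * s + b)).
Proof.
have := @is_derive1_comp R expR (fun x => a * x + b) s _ _
  (is_derive_expR _) (is_derive_affine a b s).
by rewrite mulrC.
Qed.

Lemma is_derive_cosh_half s :
  is_derive s (1 : R) (fun x => cosh (x / 2)) (sinh (s / 2) / 2).
Proof.
have := is_deriveZ (2^-1 : R) (is_deriveD
  (is_derive_expR_affine 2^-1 0 s) (is_derive_expR_affine (- 2^-1) 0 s)).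
congr is_derive.
  apply/funext => x; transitivity
    (2^-1 * (expR (2^-1 * x + 0) + expR (- 2^-1 * x + 0))) => //.
  by rewrite /cosh !addr0 mulNr (mulrC 2^-1 x) [LHS]mulrC.
by rewrite /sinh !addr0 (mulNr 2^-1 s) (mulrC 2^-1 s) /GRing.scale /=; field.
Qed.

Lemma is_derive_sinh_half s :
  is_derive s (1 : R) (fun x => sinh (x / 2)) (cosh (s / 2) / 2).
Proof.
have := is_deriveZ (2^-1 : R) (is_deriveB
  (is_derive_expR_affine 2^-1 0 s) (is_derive_expR_affine (- 2^-1) 0 s)).
congr is_derive.
  apply/funext => x; transitivity
    (2^-1 * (expR (2^-1 * x + 0) - expR (- 2^-1 * x + 0))) => //.
  by rewrite /sinh !addr0 mulNr (mulrC 2^-1 x) [LHS]mulrC.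
by rewrite /cosh !addr0 (mulNr 2^-1 s) (mulrC 2^-1 s) /GRing.scale /=; field.
Qed.

Lemma is_derive_tanh_half s :
  is_derive s (1 : R) (fun x => tanh (x / 2)) (2^-1 * (cosh (s / 2)) ^- 2).
Proof.
have := is_deriveM (is_derive_sinh_half s)
  (@is_deriveV R (fun x => cosh (x / 2)) s _ _ (cosh_neq0 _)
    (is_derive_cosh_half s)).
congr is_derive; first by apply/funext => x; rewrite tanhE.
have h := cosh_neq0 (s / 2).
rewrite /GRing.scale /=.
transitivity (((cosh (s / 2)) ^+ 2 - (sinh (s / 2)) ^+ 2) *
  (2^-1 * (cosh (s / 2)) ^- 2)); first by field; rewrite h.
by rewrite cosh2_sinh2 addrAC subrr add0r mul1r.
Qed.

Lemma is_derive_ln_cosh_half s :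
  is_derive s (1 : R) (fun x => ln (cosh (x / 2))) (2^-1 * tanh (s / 2)).
Proof.
have := @is_derive1_comp R (@ln R) (fun x => cosh (x / 2)) s _ _
  (is_derive1_ln (cosh_gt0 (s / 2))) (is_derive_cosh_half s).
by congr is_derive; rewrite tanhE mulrC; ring.
Qed.

Lemma is_derive_sech2_half s : is_derive s (1 : R)
  (fun x => (cosh (x / 2)) ^- 2) (- tanh (s / 2) * (cosh (s / 2)) ^- 2).
Proof.
have c0 := cosh_neq0 (s / 2).
have h := @is_deriveV R (fun x => cosh (x / 2)) s _ _ c0 (is_derive_cosh_half s).
have := is_deriveM h h.
congr is_derive; first by apply/funext => x; rewrite !fctE -invfM -expr2.
by rewrite /GRing.scale /= tanhE; field; rewrite c0.
Qed.

End Hyperbolic.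

(** * Geodesics normal to the orbit W *)

Section Orbit.
Context {R : realType} {m : nat}.
Notation Ga := 'rV[R]_(m + m).
Notation V := 'rV[R]_(1 + (m + m) + 1).
Implicit Types (p q X Y T : V) (U : Ga).

Lemma gmulg1 p : gmul p gone = p.
Proof.
rewrite gone_mk /gmul !mkK scaler0 mulr0 dot0r mulr0 !addr0.
exact: mk_eta.
Qed.

Variable w : {vspace Ga}.

Lemma linear_oproj_cU : linear (fun p : V => oproj w (cU p)).
Proof. by move=> a X Y; rewrite linear_cU linear_oproj. Qed.

(** The component of [c] in the complement of [w] satisfies the cocycle rule [PhiD]. Its derivative
    at any time is therefore a multiple of its derivative at 0, which vanishes because [X] lies in
    [s_alg w]. *)
Lemma one_parameter_orbit (c : R -> V) X : s_alg w X -> one_parameter c X ->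
  forall s, cU (c s) \in w.
Proof.
move=> [a [U [b [Uw XE]]]] [cD dc0 c0X].
pose Phi s := oproj w (cU (c s)).
have PhiD s h : Phi (s + h) = Phi s + expR (ca (c s) / 2) *: Phi h.
  by rewrite /Phi cD /gmul !mkK linearD linearZ.
have Phi0 : Phi 0 = 0.
  have := PhiD 0 0; rewrite addr0 -[LHS]addr0 => /addrI/esym/eqP.
  by rewrite scaler_eq0 gt_eqF ?expR_gt0 // => /eqP.
have dPhi0 : is_derive (0 : R) (1 : R) Phi 0.
  have -> : (0 : Ga) = oproj w (cU X).
    apply/esym/eqP; rewrite oproj_eq0 XE /B /Z !coordE !scaler0 add0r addr0.
    exact: Uw.
  by apply: (is_derive_linear_curve linear_oproj_cU); apply/is_derive1E.
have dPhi s : is_derive s (1 : R) Phi 0.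
  have cv : (fun h : R => h^-1 *: ((Phi \o shift s) (h *: (1 : R)) - Phi s)) @ 0^' --> (0 : Ga).
    case: dPhi0 => d0; rewrite /derive => l0.
    have := d0; rewrite /derivable => /cvg_ex[l cl].
    have l00 : l = 0 by rewrite -l0; apply/esym/cvg_lim.
    have -> : (0 : Ga) = expR (ca (c s) / 2) *: l by rewrite l00 scaler0.
    apply: cvg_trans (cvgZl_tmp (k := expR (ca (c s) / 2)) cl).
    apply: near_eq_cvg; near=> h.
    rewrite /= Phi0 subr0 addr0 (addrC _ s) PhiD (addrC (Phi s)) addrK.
    by rewrite !scalerA mulrC.
  by apply: DeriveDef; [apply/cvg_ex; exists 0|apply: cvg_lim].
move=> s; rewrite -oproj_eq0 -/(Phi s).
by rewrite (is_derive_0_cst_rV s 0 dPhi) Phi0.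
Unshelve. all: by end_near. Qed.

(** Membership of [cU] in [w] is stable under products. Conversely, each such point is the product
    of an element of the nilpotent part and an element of the one-parameter group of [B]. *)
Lemma WorbE : Worb w = [set p | cU p \in w].
Proof.
apply/seteqP; split=> [_ [p [l [hl ->]] <-]|p /= pw].
  rewrite gmulg1 /=; elim: l hl => [_|q l ih hl] /=.
    by rewrite gone_mk mkK mem0v.
  rewrite /gmul mkK memvD //.
    have [X [c [sX cX <-]]] := hl q (mem_head _ _).
    exact: (one_parameter_orbit sX cX).
  by rewrite memvZ // ih // => x xl; apply: hl; rewrite in_cons xl orbT.
(* For the two factors used below, the one-parameter subgroup is a straight line in the coordinates,
   so each factor is its own exponential. *)
have lineP X : s_alg w X -> (forall s t : R, gmul (s *: X) (t *: X) = (s + t) *: X) ->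
    Exp_image (s_alg w) X.
  move=> sX XD; exists X, (fun s => s *: X); split => //; last exact: scale1r.
  have [d e] : derivable (fun s : R => s *: X) 0 1 /\
      derive1 (fun s : R => s *: X) 0 = X.
    apply/is_derive1E; rewrite -[X in is_derive _ _ _ X]scale1r.
    by apply: is_derive_scale; exact: is_derive_id.
  by split=> // s t; rewrite XD.
exists p; last exact: gmulg1.
exists [:: mk 0 (cU p) (cz p); mk (ca p) 0 0]; split=> [q|]; last first.
  rewrite /= gmulg1 /gmul !mkK mul0r expR0 scaler0 dot0r !mulr0 !addr0 add0r.
  by rewrite mk_eta.
rewrite !inE => /orP[] /eqP ->; apply: lineP.
- exists 0, (cU p), (cz p); split=> //.
  by rewrite scale0r add0r /Z mkZ mkD !scaler0 mulr0 mulr1 !addr0 add0r.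
- move=> s t; rewrite !mkZ /gmul !mkK !mulr0 mul0r expR0 scale1r !mul1r.
  by rewrite JaZ dotZl dotZr dot_Ja_self !mulr0 !addr0 scalerDl mulrDl.
- exists (ca p), 0, 0; split; first exact: mem0v.
  by rewrite scale0r addr0 /B mkZ mkD !scaler0 mulr0 mulr1 !addr0.
- move=> s t; rewrite !mkZ /gmul !mkK !scaler0 !mulr0 dot0r !mulr0 !addr0.
  by rewrite mulrDl.
Qed.

Lemma tangent_WorbE p : cU p \in w -> tangent (Worb w) p = [set X | cU X \in w].
Proof.
move=> pw; apply/seteqP; split=> X /=.
  move=> [c [c0 cW dc cX]].
  have dX : is_derive (0 : R) (1 : R) c X by apply/is_derive1E.
  have d1 := is_derive_linear_curve linear_oproj_cU dX.
  have d2 : is_derive (0 : R) (1 : R) (fun s => oproj w (cU (c s))) 0.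
    apply: (@near_eq_is_derive R R Ga (cst (0 : Ga))).
    near=> s; apply/esym/eqP; rewrite oproj_eq0.
    have : Worb w (c s) by near: s.
    by rewrite WorbE.
  case: d1 => _ /=; case: d2 => _ -> /esym/eqP.
  by rewrite oproj_eq0.
move=> Xw; exists (fun s => p + s *: X).
have d : is_derive (0 : R) (1 : R) (fun s => p + s *: X) X.
  rewrite -[X in is_derive _ _ _ X]add0r -{2}(scale1r X).
  apply: is_deriveD; apply: is_derive_scale; exact: is_derive_id.
have [d1 d2] := (proj1 (is_derive1E _ _ _) d).
split => //; first by rewrite scale0r addr0.
by near=> s; rewrite WorbE /= !coordE memvD // memvZ.
Unshelve. all: by end_near. Qed.

End Orbit.

(** * The geodesic equation and its first integrals *)

Section Geodesics.
Context {R : realType} {m : nat}.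
Notation Ga := 'rV[R]_(m + m).
Notation V := 'rV[R]_(1 + (m + m) + 1).
Implicit Types (p q X Y T v a : V) (U : Ga).
Local Opaque dL dLinv gCH.

Lemma is_derive_dot (f g : R -> Ga) (s : R) (df dg : Ga) :
  is_derive s (1 : R) f df -> is_derive s (1 : R) g dg ->
  is_derive s (1 : R) (fun x => dot (f x) (g x)) (dot df (g s) + dot (f s) dg).
Proof.
move=> Df Dg.
have c (h : R -> Ga) dh i : is_derive s (1 : R) h dh ->
    is_derive s (1 : R) (fun x => h x 0 i) (dh 0 i).
  have l : linear ((fun v : Ga => v 0 i) : Ga -> R^o).
    by move=> a u v; rewrite !mxE.
  exact: (is_derive_linear_curve l).
have := is_derive_sum (fun i => is_deriveM (c _ _ i Df) (c _ _ i Dg)).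
congr is_derive; first by apply/funext => x; rewrite fct_sumE.
rewrite /dot -big_split; apply: eq_bigr => i _ /=.
by rewrite addrC; congr (_ + _); exact: mulrC.
Qed.

Lemma linear_Ja : linear (@Ja R m).
Proof. by move=> a u v; rewrite JaD JaZ. Qed.

Lemma dot_inj (U1 U2 : Ga) : (forall U, dot U U1 = dot U U2) -> U1 = U2.
Proof.
move=> h; apply/eqP; rewrite -subr_eq0 -dot_eq0 dotBr h subrr //.
Qed.

(** The equation is split along the left-invariant frame. Stating the last component with
    [theta p a] rather than [cz a] makes the conservation law behind [theta0] visible. *)
Lemma geodesic_eqP p v a : a + Gamma gCH p v v = 0 <->
  [/\ ca a = - (2^-1 * (expR (- ca p) * dot (cU v) (cU v)) +
                expR (- ca p) * expR (- ca p) * (theta p v * theta p v)),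
      cU a = ca v *: cU v + (expR (- ca p) * theta p v) *: Ja (cU v)
    & theta p a = 2 * ca v * theta p v].
Proof.
have ep := expR_gt0 (- ca p); have eh := expR_gt0 (- ca p / 2).
have -> : (a + Gamma gCH p v v = 0) <-> (dLinv p a = - Ghat (dLinv p v) (dLinv p v)).
  rewrite -dLinv_Gamma; split=> [/eqP|/eqP].
    by rewrite addr_eq0 => /eqP ->; rewrite dLinvN.
  rewrite -addr_eq0 -dLinvD => /eqP e; rewrite -[LHS](dLVK p) e; exact: dL0.
rewrite !dLinvE /Ghat !mkK mkN dotZl dotZr JaZ.
have -> : 2^-1 * (expR (- ca p / 2) * (expR (- ca p / 2) * dot (cU v) (cU v))) +
    expR (- ca p) * theta p v * (expR (- ca p) * theta p v) =
    2^-1 * (expR (- ca p) * dot (cU v) (cU v)) +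
    expR (- ca p) * expR (- ca p) * (theta p v * theta p v).
  by rewrite -[X in _ = _ * (X * _) + _](expR_half (- ca p)); ring.
have -> : - (- 2^-1 *: (ca v *: (expR (- ca p / 2) *: cU v) +
     ca v *: (expR (- ca p / 2) *: cU v) +
     (expR (- ca p) * theta p v) *: (expR (- ca p / 2) *: Ja (cU v)) +
     (expR (- ca p) * theta p v) *: (expR (- ca p / 2) *: Ja (cU v)))) =
   expR (- ca p / 2) *: (ca v *: cU v + (expR (- ca p) * theta p v) *: Ja (cU v)).
  by apply/rowP => i; rewrite !mxE; field.
have -> : - - (ca v * (expR (- ca p) * theta p v) + ca v * (expR (- ca p) * theta p v))
  = expR (- ca p) * (2 * ca v * theta p v) by ring.
split=> [/mk_inj[-> /(scalerI (lt0r_neq0 eh)) -> /(mulfI (lt0r_neq0 ep)) ->] //|].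
by case=> -> -> ->.
Qed.

Variable w : {vspace Ga}.

Lemma normal_WorbP p v : cU p \in w -> normal gCH (Worb w) p v <->
  [/\ ca v = 0, cU v \in orthcv w & theta p v = 0].
Proof.
move=> pw; split=> [nv|[a0 vo t0] X]; last first.
  rewrite tangent_WorbE //= => Xw.
  by rewrite gCH_theta a0 t0 (dot_orthcv vo Xw) !mul0r !mulr0 !addr0.
have nX X : cU X \in w -> gCH p v X = 0.
  by move=> Xw; apply: nv; rewrite tangent_WorbE.
have t0 : theta p v = 0.
  have := nX (mk 0 0 1); rewrite gCH_theta /theta !mkK !dot0r !mulr0 add0r subr0 mulr1.
  rewrite add0r => /(_ (mem0v _))/eqP; rewrite mulf_eq0 gt_eqF //=.
    by move/eqP.
  by rewrite mulr_gt0 ?expR_gt0.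
split=> //.
  have := nX (mk 1 0 0); rewrite gCH_theta t0 !mkK dot0r mulr0 mul0r mulr0.
  by rewrite !addr0 mulr1 => ->; rewrite ?mem0v.
apply/orthcvP => U Uw.
have := nX (mk 0 U 0); rewrite gCH_theta t0 !mkK mulr0 mul0r mulr0 add0r addr0.
by move=> /(_ Uw)/eqP; rewrite mulf_eq0 gt_eqF ?expR_gt0 //= => /eqP.
Qed.

Section FirstIntegrals.
Variable c : R -> V.
Hypothesis gc : unit_normal_geodesic gCH (Worb w) c.
Let c' := derive1 c.
Let c'' := derive1 c'.
Let t0 := ca (c 0).
Let xi := cU (c' 0).

Let W0 : cU (c 0) \in w.
Proof. by case: gc => _; rewrite WorbE. Qed.

Let dc s : is_derive s (1 : R) c (c' s).
Proof. by case: gc => /(_ s)[d1 d2 _] _ _ _; apply/is_derive1E. Qed.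

Let dc' s : is_derive s (1 : R) c' (c'' s).
Proof. by case: gc => /(_ s)[d1 d2 _] _ _ _; apply/is_derive1E. Qed.

Let eqc s :
  [/\ ca (c'' s) = - (2^-1 * (expR (- ca (c s)) * dot (cU (c' s)) (cU (c' s))) +
                expR (- ca (c s)) * expR (- ca (c s)) *
                (theta (c s) (c' s) * theta (c s) (c' s))),
      cU (c'' s) = ca (c' s) *: cU (c' s) +
        (expR (- ca (c s)) * theta (c s) (c' s)) *: Ja (cU (c' s))
    & theta (c s) (c'' s) = 2 * ca (c' s) * theta (c s) (c' s)].
Proof. by case: gc => /(_ s)[_ _ /geodesic_eqP]. Qed.

Let init : [/\ ca (c' 0) = 0, xi \in orthcv w & theta (c 0) (c' 0) = 0].
Proof. by case: gc => _ _ n _; apply/normal_WorbP. Qed.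

Let norm_xi : dot xi xi = expR t0.
Proof.
case: gc => _ _ _; rewrite -/c' gCH_theta; case: init => -> _ ->.
rewrite !mul0r !mulr0 add0r addr0 -/xi -/t0 => e.
by rewrite -[LHS]mul1r -(expR_mulN t0) -mulrA e mulr1.
Qed.

Let dca s : is_derive s (1 : R) (fun x => ca (c x)) (ca (c' s)).
Proof. exact: (is_derive_linear_curve (@linear_ca R m) (dc s)). Qed.

Let dca' s : is_derive s (1 : R) (fun x => ca (c' x)) (ca (c'' s)).
Proof. exact: (is_derive_linear_curve (@linear_ca R m) (dc' s)). Qed.

Let dcU s : is_derive s (1 : R) (fun x => cU (c x)) (cU (c' s)).
Proof. exact: (is_derive_linear_curve (@linear_cU R m) (dc s)). Qed.

Let dcU' s : is_derive s (1 : R) (fun x => cU (c' x)) (cU (c'' s)).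
Proof. exact: (is_derive_linear_curve (@linear_cU R m) (dc' s)). Qed.

Let dexp (k b s : R) : is_derive s (1 : R) (fun x => expR (k * ca (c x) + b))
  (k * ca (c' s) * expR (k * ca (c s) + b)).
Proof.
have := @is_derive1_comp R expR (fun x => k * ca (c x) + b) s _ _
  (is_derive_expR _) (is_deriveD (is_deriveZ k (dca s)) (is_derive_cst (b : R^o) s (1:R))).
by congr is_derive; rewrite addr0 mulrC.
Qed.

(** [expR (- 2 t)] times [theta], with [t = ca (c s)], is the momentum of the isometries that
    translate the last coordinate; it is zero at the start because the curve leaves W
    orthogonally. *)
Let theta0 s : theta (c s) (c' s) = 0.
Proof.
have dJ x : is_derive x (1 : R) (fun x => Ja (cU (c x))) (Ja (cU (c' x))).
  exact: (is_derive_linear_curve linear_Ja (dcU x)).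
have dcz x : is_derive x (1 : R) (fun x => cz (c' x)) (cz (c'' x)).
  exact: (is_derive_linear_curve (@linear_cz R m) (dc' x)).
have dt x : is_derive x (1 : R) (fun x => theta (c x) (c' x)) (theta (c x) (c'' x)).
  have := is_deriveB (dcz x) (is_deriveZ (2^-1 : R) (is_derive_dot (dJ x) (dcU' x))).
  by congr is_derive; rewrite dot_Ja_self add0r.
have dF x : is_derive x (1 : R)
    (fun x => theta (c x) (c' x) * expR (- 2 * ca (c x) + 0)) 0.
  have := is_deriveM (dt x) (dexp (- 2) 0 x).
  congr is_derive; case: (eqc x) => _ _ ->; rewrite /GRing.scale /=; ring.
have := is_derive_0_is_cst s 0 dF; case: init => _ _ ->; rewrite mul0r => /eqP.
by rewrite mulf_eq0 [X in _ || X]gt_eqF ?expR_gt0 // orbF => /eqP.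
Qed.

(** Once [theta] vanishes, the momentum of the left translations along [U] is
    [expR (- t) * dot U (cU c')]. *)
Let cU' s : cU (c' s) = expR (ca (c s) - t0) *: xi.
Proof.
have dF U x : is_derive x (1 : R)
    (fun x => dot U (cU (c' x)) * expR (- 1 * ca (c x) + t0)) 0.
  have := is_deriveM (is_derive_dot (is_derive_cst U x (1 : R)) (dcU' x))
    (dexp (- 1) t0 x).
  congr is_derive; case: (eqc x) => _ -> _; rewrite theta0 mulr0 scale0r addr0.
  by rewrite dot0l dotZr /GRing.scale /=; ring.
apply: dot_inj => U.
apply: etrans _ (esym (dotZr _ _ _)).
exact: expR_quotient (is_derive_0_is_cst s 0 (dF U)).
Qed.

Let ca'' s : ca (c'' s) = - (2^-1 * expR (ca (c s) - t0)).
Proof.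
case: (eqc s) => -> _ _; rewrite theta0 !mulr0 addr0 cU' dotZl dotZr norm_xi.
congr (- (_ * _)); rewrite -!expRD; congr expR; ring.
Qed.

(** This is conservation of the unit speed, with the g_alpha part rewritten by [cU'] and
    [norm_xi]. *)
Let energy s : ca (c' s) ^+ 2 = 1 - expR (ca (c s) - t0).
Proof.
have dE x : is_derive x (1 : R)
    (fun x => ca (c' x) * ca (c' x) + expR (1 * ca (c x) + - t0)) 0.
  have := is_deriveD (is_deriveM (dca' x) (dca' x)) (dexp 1 (- t0) x).
  by congr is_derive; rewrite ca'' /GRing.scale /= !mul1r; field.
have : ca (c' s) * ca (c' s) + expR (1 * ca (c s) - t0) =
    0 * 0 + expR (1 * t0 - t0).
  by apply: etrans (is_derive_0_is_cst s 0 dE) _; case: init => a0 _ _; rewrite a0.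
by rewrite !mul1r subrr expR0 mulr0 add0r -expr2 => <-; rewrite addrK.
Qed.

(* For [e = 1] and [e = - 1] these first integrals determine both [ca (c s)] and
   [ca (c' s)], which replaces the uniqueness theorem for the geodesic equation. *)
Let half_speed (e : R) : e ^+ 2 = 1 -> forall s,
  (1 - e * ca (c' s)) = expR ((ca (c s) - t0) / 2) * expR (e * (s / 2)).
Proof.
move=> e2 s.
(* With [a = ca (c' x)], [energy] reads [(1 - e a) (1 + e a) = expR (t - t0)]. Hence
   [(1 - e a) expR (- (t - t0) / 2)] has logarithmic derivative [e / 2], which the last exponential
   cancels. *)
have dG x : is_derive x (1 : R)
    (fun x => (1 - e * ca (c' x)) * (expR (- 2^-1 * ca (c x) + t0 / 2) *
                expR (- (e / 2) * x + 0))) 0.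
  have := is_deriveM (is_deriveB (is_derive_cst (1 : R^o) x (1 : R))
      (is_deriveZ e (dca' x)))
    (is_deriveM (dexp (- 2^-1) (t0 / 2) x) (is_derive_expR_affine (- (e / 2)) 0 x)).
  congr is_derive; rewrite ca'' /GRing.scale /=.
  set a := expR _; set b := expR _; set d := expR (ca _ - _).
  have -> : d = 1 - ca (c' x) ^+ 2 by rewrite energy /d; ring.
  transitivity (a * b * 2^-1 * ca (c' x) * (e ^+ 2 - 1)) ; last first.
    by rewrite e2 subrr mulr0.
  change ((1 - e * ca (c' x)) *
    (a * (- (e / 2) * b) + b * (- 2^-1 * ca (c' x) * a)) +
    a * b * (0 - e * - (2^-1 * (1 - ca (c' x) ^+ 2))) =
    a * b * 2^-1 * ca (c' x) * (e ^+ 2 - 1)).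
  by field.
have : (1 - e * ca (c' s)) * (expR (- 2^-1 * ca (c s) + t0 / 2) *
      expR (- (e / 2) * s + 0)) =
    (1 - e * 0) * (expR (- 2^-1 * t0 + t0 / 2) * expR (- (e / 2) * 0 + 0)).
  by apply: etrans (is_derive_0_is_cst s 0 dG) _; case: init => a0 _ _; rewrite a0.
rewrite !mulr0 subr0 !addr0 expR0 mulr1 mul1r.
have -> : - 2^-1 * t0 + t0 / 2 = 0 by field.
rewrite expR0 => h.
rewrite -[LHS]mulr1 -[X in _ * X](expR_mulN ((ca (c s) - t0) / 2 + e * (s / 2))).
rewrite mulrCA -[in RHS]expRD -[RHS]mulr1; congr (_ * _).
by rewrite -[RHS]h; congr (_ * _); rewrite -expRD; congr expR; field.
Qed.

(** The sum of the two cases of [half_speed] gives the height, their difference gives [ca (c' s)].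
    No formula for [cz (c s)] appears because neither the cone nor the normal field depends on that
    coordinate. *)
Lemma normal_geodesic_form s :
  [/\ expR ((ca (c s) - t0) / 2) = (cosh (s / 2))^-1,
      cU (c s) = cU (c 0) + (2 * tanh (s / 2)) *: xi
    & c' s = mk (- tanh (s / 2)) ((cosh (s / 2)) ^- 2 *: xi)
       (2^-1 * dot (Ja (cU (c s))) ((cosh (s / 2)) ^- 2 *: xi))].
Proof.
have h1 x := half_speed (expr1n R 2) x.
have h2 x := half_speed (etrans (sqrrN 1) (expr1n R 2)) x.
have e x : expR ((ca (c x) - t0) / 2) = (cosh (x / 2))^-1.
  have ch := cosh_neq0 (x / 2).
  apply: (mulIf ch); rewrite mulVf // /cosh.
  have := h1 x; have := h2 x; rewrite !mulN1r !mul1r opprK => k1 k2.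
  have : 2 = expR ((ca (c x) - t0) / 2) * (expR (x / 2) + expR (- (x / 2))).
    by rewrite mulrDr -k1 -k2; ring.
  by move=> k; rewrite mulrA -k; field.
have e2 x : expR (ca (c x) - t0) = (cosh (x / 2)) ^- 2.
  by rewrite -expR_half e -invfM -expr2.
have a' : ca (c' s) = - tanh (s / 2).
  have := h1 s; have := h2 s; rewrite e !mulN1r !mul1r opprK => k1 k2.
  rewrite tanhE /sinh.
  have -> : ca (c' s) = ((1 + ca (c' s)) - (1 - ca (c' s))) / 2 by field.
  by rewrite k1 k2; field; rewrite cosh_neq0.
split=> //.
  have dF x : is_derive x (1 : R) (fun x => cU (c x) - (2 * tanh (x / 2)) *: xi) 0.
    have := is_deriveB (dcU x)
      (is_derive_scale xi (is_deriveZ (2 : R) (is_derive_tanh_half x))).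
    congr is_derive; rewrite cU' e2 -scalerBl; rewrite [X in X *: _](_ : _ = 0) ?scale0r //.
    by rewrite /GRing.scale /=; field; rewrite cosh_neq0.
  have := is_derive_0_cst_rV s 0 dF.
  by rewrite mul0r tanh0 mulr0 scale0r subr0 => <-; rewrite subrK.
rewrite -[LHS]mk_eta a' cU' e2; congr mk.
by have := theta0 s; rewrite /theta cU' e2 => /eqP; rewrite subr_eq0 => /eqP.
Qed.

Lemma normal_geodesic_init :
  [/\ cU (c 0) \in w, xi \in orthcv w & dot xi xi = expR t0].
Proof. by case: init. Qed.

End FirstIntegrals.
End Geodesics.

(** * The tube *)

Section Tube.
Context {R : realType} {m : nat}.
Notation Ga := 'rV[R]_(m + m).
Notation V := 'rV[R]_(1 + (m + m) + 1).
Implicit Types (p q X Y T v a : V) (U : Ga).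
Local Opaque dL dLinv gCH.
Variable w : {vspace Ga}.
Notation Q p := (oproj w (cU p)).

Section ExplicitGeodesic.
Variables (p0 : V) (xi : Ga).
Hypotheses (p0w : cU p0 \in w) (xiw : xi \in orthcv w).
Hypothesis norm_xi : dot xi xi = expR (ca p0).

Let X0 : V := mk 0 xi (2^-1 * dot (Ja (cU p0)) xi).

(* In the half-plane with abscissa along [xi] and height [expR (ca p / 2)], this is
   the half circle parametrized by arc length. *)
Definition normal_geodesic (s : R) : V :=
  p0 + ((- 2 * ln (cosh (s / 2))) *: (B : V) + (2 * tanh (s / 2)) *: X0).

Let c' (s : R) : V := - tanh (s / 2) *: (B : V) + (cosh (s / 2)) ^- 2 *: X0.
Let c'' (s : R) : V := (- 2^-1 * (cosh (s / 2)) ^- 2) *: (B : V) +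
  (- tanh (s / 2) * (cosh (s / 2)) ^- 2) *: X0.

Let dc (s : R) : is_derive s (1 : R) normal_geodesic (c' s).
Proof.
have := is_deriveD (is_derive_cst p0 s (1 : R))
  (is_deriveD (is_derive_scale B (is_deriveZ (- 2 : R) (is_derive_ln_cosh_half s)))
     (is_derive_scale X0 (is_deriveZ (2 : R) (is_derive_tanh_half s)))).
congr is_derive; rewrite add0r /c' /GRing.scale /=.
by congr (_ *: _ + _ *: _); field; rewrite ?cosh_neq0.
Qed.

Let dc' (s : R) : is_derive s (1 : R) c' (c'' s).
Proof.
have := is_deriveD
  (is_derive_scale B (is_deriveN (is_derive_tanh_half s)))
  (is_derive_scale X0 (is_derive_sech2_half s)).
by congr is_derive; rewrite -mulNr.
Qed.

Let ca_geo s : ca (normal_geodesic s) = ca p0 - 2 * ln (cosh (s / 2)).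
Proof. by rewrite /normal_geodesic /X0 /B !coordE mulr1 mulr0 addr0 mulNr. Qed.

Let cU_geo s : cU (normal_geodesic s) = cU p0 + (2 * tanh (s / 2)) *: xi.
Proof. by rewrite /normal_geodesic /X0 /B !coordE scaler0 add0r. Qed.

Lemma normal_geodesic_unit_normal : unit_normal_geodesic gCH (Worb w) normal_geodesic.
Proof.
have e1 : derive1 normal_geodesic = c'.
  by apply/funext => s; have [] := proj1 (is_derive1E _ _ _) (dc s).
have e2 : derive1 c' = c''.
  by apply/funext => s; have [] := proj1 (is_derive1E _ _ _) (dc' s).
have g0 : normal_geodesic 0 = p0.
  by rewrite /normal_geodesic mul0r cosh0 ln1 tanh0 !mulr0 !scale0r !addr0.
have c'0 : c' 0 = X0.
  by rewrite /c' mul0r cosh0 tanh0 oppr0 scale0r add0r expr1n invr1 scale1r.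
have th0 q x y : theta q (x *: (B : V) + y *: mk 0 xi (2^-1 * dot (Ja (cU q)) xi)) = 0.
  by rewrite /theta /B !coordE scaler0 add0r mulr0 add0r dotZr; ring.
split.
- move=> s; rewrite e1 e2; split; [by case: (dc s)|by case: (dc' s)|].
  (* Moving [cU] along [xi] leaves [dot (Ja (cU _)) xi] unchanged, so [X0] stays in the kernel of
     [theta] all along the curve. *)
  have eX : X0 = mk 0 xi (2^-1 * dot (Ja (cU (normal_geodesic s))) xi).
    by rewrite cU_geo JaD JaZ !dotE dot_Ja_self mulr0 addr0.
  apply/geodesic_eqP.
  have -> : theta (normal_geodesic s) (c' s) = 0 by rewrite /c' eX th0.
  have -> : theta (normal_geodesic s) (c'' s) = 0 by rewrite /c'' eX th0.
  rewrite !mulr0 scale0r !addr0.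
  have ac' : ca (c' s) = - tanh (s / 2).
    by rewrite /c' /X0 /B !coordE mulr1 mulr0 addr0.
  have uc' : cU (c' s) = (cosh (s / 2)) ^- 2 *: xi.
    by rewrite /c' /X0 /B !coordE scaler0 add0r.
  rewrite ac' uc' !dotE norm_xi; split => //.
    rewrite ca_geo /c'' /X0 /B !coordE mulr1 mulr0 addr0 mulNr; congr (- (_ * _)).
    rewrite opprB expRD expRM_natl lnK ?posrE ?cosh_gt0 //.
    transitivity ((cosh (s / 2)) ^- 2 * (expR (- ca p0) * expR (ca p0)));
      first by rewrite expR_Nmul mulr1.
    by field; rewrite ?cosh_neq0.
  by rewrite /c'' /X0 /B !coordE scaler0 add0r scalerA.
- by rewrite g0 WorbE.
- rewrite g0 e1 c'0; apply/normal_WorbP => //.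
  by rewrite /X0 /theta !mkK subrr.
- rewrite g0 e1 c'0 gCH_theta /X0 /theta !mkK subrr norm_xi.
  by rewrite !mulr0 add0r addr0 expR_Nmul.
Qed.

End ExplicitGeodesic.

Definition cone_set (d : R) : set V := [set p | dot (Q p) (Q p) = d * expR (ca p)].

(** Minus the end velocity in [normal_geodesic_form], with [xi] recovered from the end point as
    [(2 * tanh (r / 2))^-1 *: Q p]. The formula makes sense off the tube as well, which provides the
    smooth extension. *)
Definition normal_field (r : R) p : V :=
  mk (tanh (r / 2)) (- (2 * sinh (r / 2) * cosh (r / 2))^-1 *: Q p)
     (- 2^-1 * (2 * sinh (r / 2) * cosh (r / 2))^-1 * dot (Ja (cU p)) (Q p)).

Variable r : R.
Hypothesis r_gt0 : 0 < r.
Let d : R := 4 * sinh (r / 2) ^+ 2.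

Let sh_gt0 : 0 < sinh (r / 2).
Proof. by rewrite sinh_gt0 // divr_gt0. Qed.

(** Both conclusions eliminate the foot point: [Q (c r)] is a known multiple of [xi], and
    [expR (ca (c r))] a known multiple of [dot xi xi]. The constant 4 sinh^2 arises as (2 tanh)^2
    cosh^2. *)
Lemma unit_normal_geodesic_tube c : unit_normal_geodesic gCH (Worb w) c ->
  cone_set d (c r) /\ - derive1 c r = normal_field r (c r).
Proof.
move=> gc; have [e1 e2 ->] := normal_geodesic_form gc r.
have [p0w xiw nxi] := normal_geodesic_init gc.
set xi := cU (derive1 c 0) in e2 xiw nxi *; have s0 := lt0r_neq0 sh_gt0.
have c0 := cosh_neq0 (r / 2).
have QE : Q (c r) = (2 * tanh (r / 2)) *: xi.
  rewrite e2 linearD linearZ /= (oproj_id xiw).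
  by have := oproj_eq0 w (cU (c 0)); rewrite p0w => /eqP ->; rewrite add0r.
split.
  rewrite /cone_set /= QE dotZl dotZr nxi.
  have -> : ca (c r) = ca (c 0) + (ca (c r) - ca (c 0)) by rewrite addrC subrK.
  rewrite expRD -(expR_half (_ - _)) e1 /d tanhE.
  by field; rewrite ?c0.
rewrite mkN opprK /normal_field QE scalerA dotZr dotZr.
by congr mk; [rewrite -scaleNr; congr (_ *: _)|]; rewrite tanhE; field; rewrite ?c0 ?s0.
Qed.

Lemma tubeE : tube gCH (Worb w) r = cone_set d.
Proof.
have s0 := lt0r_neq0 sh_gt0; have c0 := cosh_neq0 (r / 2).
apply/seteqP; split=> [_ [c gc <-]|p pd]; first by have [] := unit_normal_geodesic_tube gc.
have t0 : 2 * tanh (r / 2) != 0.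
  by rewrite mulf_neq0 ?pnatr_eq0 // tanhE mulf_neq0 // invr_eq0.
(* The initial direction and the foot [p0] on W come from solving [normal_geodesic p0 xi r = p] for
   them. *)
pose xi := (2 * tanh (r / 2))^-1 *: Q p.
pose p0 : V := mk (ca p + 2 * ln (cosh (r / 2))) (cU p - Q p)
  (cz p - tanh (r / 2) * dot (Ja (cU p - Q p)) xi).
have p0w : cU p0 \in w by rewrite mkK oproj_sub.
have xiw : xi \in orthcv w by rewrite memvZ // oproj_mem.
have nxi : dot xi xi = expR (ca p0).
  rewrite /xi /p0 mkK dotZl dotZr pd expRD expRM_natl lnK ?posrE ?cosh_gt0 //.
  by rewrite /d tanhE; field; rewrite s0 c0.
exists (normal_geodesic p0 xi); first exact: normal_geodesic_unit_normal.
rewrite /normal_geodesic /p0 /B !mkZ !mkD !mkK -[RHS]mk_eta.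
rewrite scaler0 add0r /xi scalerA mulfV // scale1r subrK.
by congr mk; [ring|set D := dot _ _; field].
Qed.

Lemma expoly_dot (f g : V -> Ga) : linear f -> linear g ->
  expoly (fun p => dot (f p) (g p)).
Proof.
move=> fl gl.
rewrite (_ : (fun _ => _) = \sum_i ((fun p => f p 0 i) * (fun p => g p 0 i))).
  elim/big_ind: _ => [|x y|i _]; [exact: expoly_cst|exact: expolyD|].
  by apply: expolyM; apply: expoly_linear => a u v; rewrite ?fl ?gl !mxE.
by apply/funext => p; rewrite fct_sumE.
Qed.

Lemma expolyV_normal_field : expolyV (normal_field r).
Proof.
set k := (2 * sinh (r / 2) * cosh (r / 2))^-1.
rewrite (_ : normal_field r = cst (tanh (r / 2) *: (B : V)) +
  (fun p => mk 0 (- k *: Q p) 0) +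
  (fun p => (- 2^-1 * k * dot (Ja (cU p)) (Q p)) *: (Z : V))).
  apply: expolyVD; first apply: expolyVD.
  - exact: expolyV_cst.
  - apply: expolyV_linear => a u v; rewrite linear_oproj_cU mkZ mkD.
    rewrite scalerDr !scalerA [a * - k]mulrC; congr mk; ring.
  - apply: (expolyVZ _ (f := fun p => - 2^-1 * k * dot (Ja (cU p)) (Q p))).
    rewrite (_ : (fun _ => _) = cst (- 2^-1 * k) * (fun p => dot (Ja (cU p)) (Q p))) //.
    apply: expolyM; first exact: expoly_cst.
    apply: expoly_dot; last exact: linear_oproj_cU.
    by move=> a u v; rewrite linear_cU linear_Ja.
apply/funext => p; rewrite /normal_field -/k !fctE /cst /B /Z !mkZ !mkD.
by rewrite !scaler0 !mulr0 !mulr1 !addr0 !add0r.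
Qed.

Lemma smooth_normal_field O : smooth_on O (normal_field r).
Proof. exact/expolyV_smooth/expolyV_normal_field. Qed.

(** The definition lets the geodesic through a point of the tube be chosen, but its end velocity is
    determined by that point; hence all inward normals agree on the tube. *)
Lemma inward_unit_normalP eta : inward_unit_normal gCH (Worb w) r eta <->
  (exists O, [/\ open O, tube gCH (Worb w) r `<=` O & smooth_on O eta]) /\
  (forall p, cone_set d p -> eta p = normal_field r p).
Proof.
split=> -[etaO h]; split=> // p; rewrite -?tubeE => pM.
  have [c [gc cr ->]] := h p pM.
  by have [_ ->] := unit_normal_geodesic_tube gc; rewrite cr.
have [c gc cr] := pM; exists c; split=> //.
have [cd ->] := unit_normal_geodesic_tube gc.
by rewrite cr h // -cr.
Qed.

Lemma inward_normal_field : inward_unit_normal gCH (Worb w) r (normal_field r).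
Proof.
apply/inward_unit_normalP; split=> //.
by exists setT; split => //; [exact: openT|exact: smooth_normal_field].
Qed.

Let F p := dot (Q p) (Q p) - d * expR (ca p).

Let expoly_F : expoly F.
Proof.
rewrite (_ : F = (fun p => dot (Q p) (Q p)) + cst (- d) * (fun p => expR (ca p))).
  apply: expolyD; first by apply: expoly_dot; exact: linear_oproj_cU.
  by apply: expolyM; [exact: expoly_cst|apply: expoly_exp; exact: linear_ca].
by apply/funext => p; rewrite /F -mulNr.
Qed.

Let derive_F p v : 'D_v F p =
  2 * dot (Q p) (cU v) - d * ca v * expR (ca p).
Proof.
have [dF _] := expoly_derive expoly_F.
have dc : is_derive (0 : R) (1 : R) (fun s => p + s *: v) v.
  rewrite -[X in is_derive _ _ _ X]add0r -{2}(scale1r v).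
  apply: is_deriveD; apply: is_derive_scale; exact: is_derive_id.
have c0 : p + 0 *: v = p by rewrite scale0r addr0.
have [_] := is_derive_curve (f := F : V -> R^o) (dF _) dc.
rewrite c0 => <-.
have dq := is_derive_linear_curve (linear_oproj_cU w) dc.
have da := is_derive_linear_curve (@linear_ca R m) dc.
have [_ e] := is_deriveB (is_derive_dot dq dq) (is_deriveZ d
  (@is_derive1_comp R expR _ 0 _ _ (is_derive_expR _) da)).
apply: etrans e _; rewrite /= c0 (dotC _ (Q p)) dot_oproj ?oproj_mem //.
by rewrite /GRing.scale /=; ring.
Qed.

Let d_gt0 : 0 < d.
Proof. by rewrite mulr_gt0 // exprn_gt0. Qed.

Lemma cone_setE p : cone_set d p <-> F p = 0.
Proof.
rewrite /cone_set /F /=; split=> [->|/eqP]; first by rewrite subrr.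
by rewrite subr_eq0 => /eqP.
Qed.

Lemma smooth_hypersurface_cone_set : smooth_hypersurface (cone_set d).
Proof.
move=> p _; exists setT, F; split => //.
- exact: openT.
- exact: expoly_smooth.
- by move=> q _; exact: cone_setE.
move=> q _ _; exists B; rewrite derive_F /B mkK dot0r mulr0 mkK mulr1 add0r.
by rewrite oppr_eq0 mulf_neq0 ?gt_eqF ?expR_gt0.
Qed.

Lemma tangent_cone_set p : cone_set d p -> tangent (cone_set d) p =
  [set X | 2 * dot (Q p) (cU X) = ca X * dot (Q p) (Q p)].
Proof.
move=> pM; apply/seteqP; split=> X /=.
  move=> [c [c0 cM dc cX]].
  have dX : is_derive (0 : R) (1 : R) c X by apply/is_derive1E.
  have [dF _] := expoly_derive expoly_F.
  have [_ d1] := is_derive_curve (f := F : V -> R^o) (dF _) dX.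
  have [_ d2] : is_derive (0 : R) (1 : R) (F \o c : R -> R^o) 0.
    apply: (@near_eq_is_derive R R R^o (cst (0 : R))).
    near=> s; apply/esym/cone_setE.
    by near: s.
  move/eqP: d1; rewrite d2 c0 derive_F pM eq_sym subr_eq0 => /eqP ->; ring.
move=> XE.
pose q (s : R) := dot (Q p + s *: oproj w (cU X)) (Q p + s *: oproj w (cU X)).
pose h (s : R) := ln (q s) + (- ca X * s + (- ca p - ln d)).
(* The [ca]-coordinate of the line [p + s *: X] is corrected so that the curve
   stays in the cone. *)
pose c (s : R) : V := (p + s *: X) + h s *: (B : V).
have dQ : is_derive (0 : R) (1 : R) (fun s => Q p + s *: oproj w (cU X)) (oproj w (cU X)).
  rewrite -[X in is_derive _ _ _ X]add0r -{2}(scale1r (oproj w (cU X))).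
  apply: is_deriveD; apply: is_derive_scale; exact: is_derive_id.
have dp : is_derive (0 : R) (1 : R) (fun s => p + s *: X) X.
  rewrite -[X in is_derive _ _ _ X]add0r -{2}(scale1r X).
  apply: is_deriveD; apply: is_derive_scale; exact: is_derive_id.
have q0E : q 0 = dot (Q p) (Q p) by rewrite /q scale0r addr0.
have q0 : 0 < q 0 by rewrite q0E pM mulr_gt0 // expR_gt0.
have dq : is_derive (0 : R) (1 : R) q (ca X * q 0).
  have := is_derive_dot dQ dQ; congr is_derive.
  rewrite scale0r addr0 (dotC _ (Q p)) dot_oproj ?oproj_mem // q0E -XE; ring.
have dh : is_derive (0 : R) (1 : R) h 0.
  have := is_deriveD (@is_derive1_comp R (@ln R) q 0 _ _ (is_derive1_ln q0) dq)
    (is_derive_affine (- ca X) (- ca p - ln d) 0).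
  by congr is_derive; field; rewrite ?gt_eqF.
have h0 : h 0 = 0.
  rewrite /h q0E pM lnM ?posrE ?expR_gt0 // expRK; ring.
have dc : is_derive (0 : R) (1 : R) c X.
  have := is_deriveD dp (is_derive_scale (B : V) dh).
  by rewrite scale0r addr0.
have [c1 c2] := proj1 (is_derive1E _ _ _) dc.
have qc : {for 0, continuous q}.
  by apply: differentiable_continuous; apply/derivable1_diffP; case: dq.
exists c; split => //; first by rewrite /c scale0r addr0 h0 scale0r addr0.
near=> s.
have qs : 0 < q s by near: s; exact: (cvgr_gt _ qc).
have cas : ca (c s) = ln (q s) - ln d.
  by rewrite /c /B !coordE mulr1 /h; ring.
have cUs : cU (c s) = cU p + s *: cU X.
  by rewrite /c /B !coordE scaler0 addr0.
rewrite /cone_set /= cas cUs linearD linearZ /= -/(q s) expRD expRN !lnK ?posrE //.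
by field; rewrite gt_eqF.
Unshelve. all: by end_near. Qed.

End Tube.

(** * The shape operator and its eigenspaces *)

Section ShapeOperator.
Context {R : realType} {m : nat}.
Notation Ga := 'rV[R]_(m + m).
Notation V := 'rV[R]_(1 + (m + m) + 1).
Implicit Types (X Y T v a x y : V) (U : Ga).
Local Opaque dL dLinv gCH.
Variables (w : {vspace Ga}) (r : R).
Hypothesis r_gt0 : 0 < r.
Notation Q p := (oproj w (cU p)).
Let d : R := 4 * sinh (r / 2) ^+ 2.
Let tau : R := tanh (r / 2).
Let kap : R := (2 * sinh (r / 2) * cosh (r / 2))^-1.

Variable p : V.
Hypothesis pM : cone_set w d p.
Let q : Ga := expR (- ca p / 2) *: Q p.

Lemma is_derive_normal_field X : 'D_X (normal_field w r) p =
  mk 0 (- kap *: Q X)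
    (- 2^-1 * kap * (dot (Ja (cU X)) (Q p) + dot (Ja (cU p)) (Q X))).
Proof.
have [df _] := expolyV_derive (expolyV_normal_field w r).
have dc : is_derive (0 : R) (1 : R) (fun s => p + s *: X) X.
  rewrite -[X in is_derive _ _ _ X]add0r -{2}(scale1r X).
  apply: is_deriveD; apply: is_derive_scale; exact: is_derive_id.
have c0 : p + 0 *: X = p by rewrite scale0r addr0.
have [_] := is_derive_curve (df _) dc; rewrite c0 => <-.
have dq := is_derive_linear_curve (linear_oproj_cU w) dc.
have dU := is_derive_linear_curve (@linear_cU R m) dc.
have dJ := is_derive_linear_curve linear_Ja dU.
have l : linear (fun U : Ga => mk 0 (- kap *: U) 0 : V).
  move=> a u v; rewrite mkZ mkD scalerDr !scalerA [a * - kap]mulrC.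
  by congr mk; ring.
have dq' := is_derive_linear_curve l dq.
have D := is_deriveD (is_derive_cst (tau *: (B : V)) (0 : R) (1 : R))
  (is_deriveD dq' (is_derive_scale (Z : V)
     (is_deriveZ (- 2^-1 * kap) (is_derive_dot dJ dq)))).
have {D} [] // : is_derive (0 : R) (1 : R) (normal_field w r \o (fun s => p + s *: X))
  (mk 0 (- kap *: Q X)
    (- 2^-1 * kap * (dot (Ja (cU X)) (Q p) + dot (Ja (cU p)) (Q X)))).
move: D; congr is_derive.
  apply/funext => s; transitivity (tau *: (B : V) + (mk 0 (- kap *: Q (p + s *: X)) 0 +
     (- 2^-1 * kap * dot (Ja (cU (p + s *: X))) (Q (p + s *: X))) *: (Z : V))) => //.
  rewrite /normal_field /B /Z /= -/kap -/tau !mkZ !mkD.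
  by rewrite !scaler0 !mulr0 !mulr1 !addr0 !add0r.
by rewrite /= c0 add0r /Z mkZ mkD !(scaler0, mulr0, mulr1, addr0, add0r).
Qed.

(** What minus the covariant derivative of [normal_field] becomes in the left-invariant frame; the
    point enters only through [q]. The constant [kap] is 1 / sinh r. *)
Definition shape_hat x : V :=
  mk (2^-1 * kap * dot (cU x) q)
     (kap *: (oproj w (cU x) - (2^-1 * ca x) *: q) + (2^-1 * tau) *: cU x
        - (2^-1 * kap * cz x) *: Ja q)
     (tau * cz x + 2^-1 * kap * dot (Ja (cU x)) q).

(** Orthogonality to the normal [mk tau (- kap *: q) 0], because [kap * d = 2 * tau]. *)
Definition tangent_hat x := 2 * dot q (cU x) = ca x * d.

Lemma q_orthcv : q \in orthcv w.
Proof. by rewrite memvZ // oproj_mem. Qed.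

Lemma dot_qq : dot q q = d.
Proof.
rewrite dotZl dotZr mulrA expR_half pM mulrCA expR_Nmul mulr1 //.
Qed.

Lemma dLinv_normal_field : dLinv p (normal_field w r p) = mk tau (- kap *: q) 0.
Proof.
rewrite dLinvE /normal_field /theta !mkK !scalerA [_ * - _]mulrC; congr mk.
by rewrite dotZr; set D := dot _ _; rewrite -/kap; ring.
Qed.

Lemma dLinv_nabla X :
  dLinv p (- nabla gCH X (normal_field w r) p) = shape_hat (dLinv p X).
Proof.
rewrite dLinvN /nabla dLinvD dLinv_Gamma dLinv_normal_field.
rewrite is_derive_normal_field !dLinvE /Ghat /shape_hat /theta !mkK.
rewrite mkD mkN; congr mk.
- by rewrite dotZr; ring.
- rewrite /q oprojZ !JaZ; set j := Ja (Q p); set jX := Ja (cU X).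
  by apply/rowP => i; rewrite !mxE; field.
- rewrite /q !JaZ !dotE -(expR_half (- ca p)); ring.
Qed.

Lemma tangent_hatP X : tangent (cone_set w d) p X <-> tangent_hat (dLinv p X).
Proof.
rewrite tangent_cone_set // /tangent_hat /= dLinvE !mkK /q !dotE pM.
have e0 : expR (- ca p) != 0 by rewrite gt_eqF ?expR_gt0.
have -> : 2 * (expR (- ca p / 2) * (expR (- ca p / 2) * dot (Q p) (cU X))) =
   expR (- ca p) * (2 * dot (Q p) (cU X)) by rewrite -(expR_half (- ca p)); ring.
have -> : ca X * d = expR (- ca p) * (ca X * (d * expR (ca p))).
  rewrite -[LHS]mulr1 -(expR_Nmul (ca p)); ring.
by split=> [->|/(mulfI e0)].
Qed.

(** It makes the projection in [shape] trivial, so principal vectors are plain eigenvectors of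
    [shape_hat]. *)
Lemma shape_tangent_hat x : tangent_hat x -> tangent_hat (shape_hat x).
Proof.
rewrite /tangent_hat /shape_hat !mkK.
move: q_orthcv dot_qq; move: q => q0 qo qq xt.
rewrite !dotE (dot_oproj _ qo) qq (dotC q0 (Ja q0)) dot_Ja_self (dotC (cU x)).
have -> : dot q0 (cU x) = 2^-1 * (ca x * d) by rewrite -xt; field.
have s0 := lt0r_neq0 (sinh_gt0 (divr_gt0 r_gt0 (ltr0n R 2))).
have c0 := cosh_neq0 (r / 2).
by rewrite /tau tanhE /d /kap; field; rewrite ?s0 ?c0.
Qed.

Lemma tangent_hatB x y : tangent_hat x -> tangent_hat y -> tangent_hat (x - y).
Proof.
rewrite /tangent_hat -scaleN1r !coordE dotDr dotZr => xt yt.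
transitivity (2 * dot q (cU x) - 2 * dot q (cU y)); first by ring.
by rewrite xt yt; ring.
Qed.

(** A tangent derivative can be taken along a curve inside the tube, where the two fields
    coincide. *)
Lemma nabla_inward eta X : inward_unit_normal gCH (Worb w) r eta ->
  tangent (cone_set w d) p X ->
  nabla gCH X eta p = nabla gCH X (normal_field w r) p.
Proof.
move=> ie [c [c0 cM dc cX]].
have [[N0 [_ sO seta]] etaE] := proj1 (inward_unit_normalP w r_gt0 eta) ie.
rewrite /nabla; have -> : 'D_X eta p = 'D_X (normal_field w r) p; last by rewrite etaE.
have dX : is_derive (0 : R) (1 : R) c X by apply/is_derive1E.
have pO : N0 p by apply: sO; rewrite tubeE.
have de : differentiable eta (c 0) by rewrite c0; exact: (seta [::] p pO).
have [df _] := expolyV_derive (expolyV_normal_field w r).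
have [_] := is_derive_curve de dX; rewrite c0 => <-.
have [_] := is_derive_curve (df (c 0)) dX; rewrite c0 => <-.
apply: near_eq_derive; near=> s => /=; apply: etaE.
by near: s.
Unshelve. all: by end_near. Qed.

Lemma principal_spaceP eta l X : inward_unit_normal gCH (Worb w) r eta ->
  principal_space gCH (cone_set w d) eta p l X <->
  tangent_hat (dLinv p X) /\ shape_hat (dLinv p X) = l *: dLinv p X.
Proof.
move=> ie; split=> [[Xt [lt h]]|[/tangent_hatP Xt e]].
  have Xt' := proj1 (tangent_hatP X) Xt; split=> //.
  rewrite nabla_inward // in h.
  set v := - nabla _ _ _ _ in h.
  have vE : dLinv p v = shape_hat (dLinv p X) by exact: dLinv_nabla.
  (* Being tangent, this difference is an admissible test vector for its own orthogonality, so it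
     vanishes. *)
  have vt : tangent (cone_set w d) p (v - l *: X).
    apply/tangent_hatP; rewrite dLinvB; apply: tangent_hatB.
      by rewrite vE; exact: shape_tangent_hat.
    by apply/tangent_hatP.
  have := h _ vt; rewrite gCHE => h0.
  have : dLinv p (v - l *: X) = 0.
    by apply/eqP/negPn/negP => /vdot_gt0; rewrite h0 ltxx.
  rewrite dLinvB dLinvZ vE  => /eqP.
  by rewrite subr_eq0 => /eqP.
split=> //; split=> [|z zt].
  apply/tangent_hatP; rewrite dLinvZ -e; apply: shape_tangent_hat.
  exact/tangent_hatP.
rewrite nabla_inward //; set v := - nabla _ _ _ _.
have vE : dLinv p v = shape_hat (dLinv p X) by exact: dLinv_nabla.
rewrite gCHE dLinvB dLinvZ vE e.
by rewrite subrr /vdot -(scale0r 0) !coordE dotZl !mul0r !addr0.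
Qed.

End ShapeOperator.

(** * Dimension counts for eigenspaces *)

Section Dimension.
Context {R : realType}.

Lemma has_dim_neq0 N (P : set 'rV[R]_N) e : has_dim P e ->
  (exists2 X, P X & X != 0) <-> (0 < e)%N.
Proof.
move=> [E [-> <-]]; rewrite lt0n dimv_eq0; split=> [[X XE]|E0].
  by apply: contra => /eqP E0; move: XE; rewrite /= E0 memv0.
by exists (vpick E); [exact: memv_pick|rewrite vpick0].
Qed.

Lemma has_dim_preim N (f g : 'rV[R]_N -> 'rV[R]_N) P e :
  linear f -> cancel f g -> cancel g f -> has_dim P e ->
  has_dim [set X | P (g X)] e.
Proof.
move=> fl fK gK [E [-> <-]].
pose f' : {linear 'rV[R]_N -> 'rV[R]_N} :=
  HB.pack f (GRing.isLinear.Build R _ _ *:%R f fl).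
exists (linfun f' @: E)%VS; split.
  apply/seteqP; split=> X /=.
    by move=> XE; rewrite -(gK X) -[f (g X)](lfunE f') memv_img.
  by move=> /memv_imgP[y yE ->]; rewrite (lfunE f') /= fK.
apply: limg_dim_eq; apply/eqP; rewrite -subv0; apply/subvP => x.
rewrite memv_cap memv_ker (lfunE f') /= => /andP[_ /eqP fx].
have f0 : f 0 = 0 by have := fl (-1) 0 0; rewrite scaler0 addr0 scaleN1r addNr.
by rewrite memv0 -(fK x) fx -[X in g X]f0 fK.
Qed.

Context {m : nat}.
Notation Ga := 'rV[R]_(m + m).
Notation V := 'rV[R]_(1 + (m + m) + 1).
Implicit Types (u v y : Ga).

Lemma orthcv_lineP u v : reflect (dot u v = 0) (u \in orthcv <[v]>%VS).
Proof.
apply: (iffP (orthcvP _ _)) => [h|h z /vlineP[a ->]]; first by rewrite h ?memv_line.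
by rewrite dotZr h mulr0.
Qed.

Lemma dim_cap_orthcv_line (A : {vspace Ga}) v : v \in A -> v != 0 ->
  (\dim (A :&: orthcv <[v]>)).+1 = \dim A.
Proof.
move=> vA v0.
have {2}-> : A = (<[v]> + (A :&: orthcv <[v]>))%VS.
  apply/eqP; rewrite eqEsubv; apply/andP; split; last first.
    by rewrite subv_add capvSl -memvE vA.
  apply/subvP => u uA; rewrite -[u](subrK (oproj <[v]> u)).
  have lA : u - oproj <[v]> u \in A.
    by apply: subvP (oproj_sub _ _); rewrite -memvE.
  apply: memv_add; first exact: oproj_sub.
  rewrite memv_cap oproj_mem andbT.
  by rewrite -(subKr u (oproj _ _)) memvB.
rewrite dimv_disjoint_sum ?dim_vline ?v0 //.
by apply/eqP; rewrite -subv0 -(capv_orthcv <[v]>) capvC capvS ?capvSr.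
Qed.

Definition gemb u : V := mk 0 u 0.

Fact gemb_linear : linear gemb.
Proof. by move=> a u v; rewrite /gemb mkZ mkD; congr mk; ring. Qed.
HB.instance Definition _ := GRing.isLinear.Build R Ga V *:%R gemb gemb_linear.

Lemma mem_gemb (A : {vspace Ga}) (x : V) :
  x \in (linfun gemb @: A)%VS -> exists2 u, u \in A & x = mk 0 u 0.
Proof. by move=> /memv_imgP[u uA ->]; exists u => //; rewrite lfunE. Qed.

Lemma gemb_mem (A : {vspace Ga}) u : u \in A -> mk 0 u 0 \in (linfun gemb @: A)%VS.
Proof. by move=> uA; rewrite -[mk _ _ _](lfunE gemb) memv_img. Qed.

Lemma dim_gemb (A : {vspace Ga}) : \dim (linfun gemb @: A) = \dim A.
Proof.
apply: limg_dim_eq; apply/eqP; rewrite -subv0; apply/subvP => u.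
rewrite memv_cap memv_ker lfunE /= => /andP[_ /eqP].
by rewrite /gemb -[RHS]/gone gone_mk => /mk_inj[_ -> _]; exact: mem0v.
Qed.

End Dimension.

(** * The four curvatures as numbers, and the special radius *)

Section Roots.
Context {R : realType}.

(* Characteristic polynomial of the shape operator on the plane spanned by [J q]
   and [Z]. *)
Definition chi (tau l : R) : R := l ^+ 2 - 3 / 2 * tau * l + 3 / 4 * tau ^+ 2 - 1 / 4.

Variable tau : R.
Hypothesis tau01 : 0 < tau < 1.
Let s := Num.sqrt (1 - 3 / 4 * tau ^+ 2).
Let l1 := 3 / 4 * tau - 2^-1 * s.
Let l2 := 3 / 4 * tau + 2^-1 * s.

Let tau_gt0 : 0 < tau. Proof. by case/andP: tau01. Qed.
Let tau_neq0 : tau != 0. Proof. by rewrite gt_eqF. Qed.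
Let tau2_lt1 : tau ^+ 2 < 1.
Proof. by case/andP: tau01 => t0 t1; rewrite expr_lt1 // ltW. Qed.
Let s_gt0 : 0 < s. Proof. by rewrite sqrtr_gt0; have := tau2_lt1; lra. Qed.
Let s2 : s ^+ 2 = 1 - 3 / 4 * tau ^+ 2.
Proof. by rewrite sqr_sqrtr //; have := tau2_lt1; lra. Qed.

Lemma chi_half : chi tau (2^-1 * tau) != 0.
Proof.
rewrite (_ : chi tau _ = (tau ^+ 2 - 1) / 4); last by rewrite /chi; field.
by rewrite mulf_neq0 // subr_eq0 lt_eqF.
Qed.

Lemma chi_factor l : chi tau l = (l - l1) * (l - l2).
Proof.
transitivity (l ^+ 2 - 3 / 2 * tau * l + 9 / 16 * tau ^+ 2 - 1 / 4 * s ^+ 2).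
  by rewrite s2 /chi; field.
by rewrite /l1 /l2; field.
Qed.

Lemma chi_eq0 l : (chi tau l == 0) = (l == l1) || (l == l2).
Proof. by rewrite chi_factor mulf_eq0 !subr_eq0. Qed.

Lemma chi_inv : chi tau (2 * tau)^-1 = (1 - tau ^+ 2) * (1 - 3 * tau ^+ 2) / (4 * tau ^+ 2).
Proof. by rewrite /chi; field. Qed.

(** [(2 * tau)^-1] is lambda_4, so this detects when it meets a root of [chi]; the factor
    [1 - tau ^+ 2] of [chi_inv] cannot vanish. *)
Lemma chi_inv_eq0 : (chi tau (2 * tau)^-1 == 0) = (3 * tau ^+ 2 == 1).
Proof.
rewrite chi_inv !mulf_eq0 invr_eq0 mulf_eq0 sqrf_eq0 pnatr_eq0 (negbTE tau_neq0).
rewrite !orbF subr_eq0 gt_eqF //= subr_eq0 eq_sym //.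
Qed.

Lemma root1_lt_root2 : l1 < l2.
Proof. by rewrite /l1 /l2; have := s_gt0; lra. Qed.

(** If lambda_4 is a root, then [3 * tau ^+ 2 = 1] makes it equal to [3 / 2 * tau], which is larger
    than the mean [3 / 4 * tau] of the two roots. *)
Lemma root1_neq_inv : (2 * tau)^-1 != l1.
Proof.
have [e|e] := eqVneq (3 * tau ^+ 2) 1; last first.
  apply: contra e => e; rewrite -chi_inv_eq0 chi_eq0 e //.
have -> : (2 * tau)^-1 = 3 / 2 * tau.
  transitivity (3 * tau ^+ 2 / (2 * tau)); first by rewrite e mul1r.
  by field.
by rewrite gt_eqF // /l1; have := s_gt0; have := tau_gt0; lra.
Qed.

Lemma half_neq_inv : 2^-1 * tau != (2 * tau)^-1.
Proof.
rewrite -subr_eq0 (_ : _ - _ = (tau ^+ 2 - 1) / (2 * tau)); last by field.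
by rewrite mulf_neq0 ?invr_eq0 ?mulf_neq0 ?pnatr_eq0 // subr_eq0 lt_eqF.
Qed.

Lemma special_values : 3 * tau ^+ 2 = 1 ->
  [/\ l1 = 0, l2 = (2 * tau)^-1, (2 * tau)^-1 = Num.sqrt 3 / 2
    & 2^-1 * tau = Num.sqrt 3 / 6].
Proof.
move=> e.
have r3 : Num.sqrt 3 = 3 * tau :> R.
  rewrite -(ger0_norm (_ : 0 <= 3 * tau)); last by rewrite mulr_ge0 // ltW.
  rewrite -sqrtr_sqr; congr Num.sqrt.
  transitivity (3 * (3 * tau ^+ 2)); first by rewrite e mulr1.
  by ring.
have sE : s = 3 / 2 * tau.
  rewrite -[RHS](ger0_norm (_ : 0 <= _)); last by rewrite mulr_ge0 // ltW.
  rewrite -sqrtr_sqr; congr Num.sqrt.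
  transitivity (3 * tau ^+ 2 - 3 / 4 * tau ^+ 2); first by rewrite e.
  by field.
have iE : (2 * tau)^-1 = 3 / 2 * tau.
  transitivity (3 * tau ^+ 2 / (2 * tau)); first by rewrite e mul1r.
  by field.
by rewrite /l1 /l2 sE iE r3; split; field.
Qed.

End Roots.

Section TanhSpecial.
Context {R : realType}.

Lemma tanh_half_gt0_lt1 (r : R) : 0 < r -> 0 < tanh (r / 2) < 1.
Proof.
move=> r0; have c0 := cosh_gt0 (r / 2).
rewrite tanhE; apply/andP; split; first by rewrite divr_gt0 // sinh_gt0 // divr_gt0.
rewrite ltr_pdivrMr // mul1r.
by rewrite /sinh /cosh ltr_pM2r ?invr_gt0 // ltrD2l gtrN ?expR_gt0.
Qed.

(** In terms of E = e^r the equation is E^2 - 4E + 1 = 0, with roots 2 + sqrt 3 and 2 - sqrt 3; the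
    second is below 1 and is excluded by r > 0. *)
Lemma tanh_half_special (r : R) : 0 < r ->
  r = ln (2 + Num.sqrt 3) <-> 3 * tanh (r / 2) ^+ 2 = 1.
Proof.
move=> r0.
have s3 : (Num.sqrt 3 : R) ^+ 2 = 3 by rewrite sqr_sqrtr.
have s30 : 0 <= (Num.sqrt 3 : R) by exact: sqrtr_ge0.
have s31 : 1 < (Num.sqrt 3 : R).
  by rewrite -[X in X < _]sqrtr1 ltr_sqrt ?ltr1n ?ltr0n.
have E1 : 1 < expR r by rewrite expR_gt1.
pose e := expR (r / 2).
have e0 : 0 < e by exact: expR_gt0.
have e2 : e ^+ 2 = expR r by rewrite expr2 expR_half.
have tE : tanh (r / 2) = (expR r - 1) / (expR r + 1).
  rewrite /tanh expRN -/e -e2; field.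
  by rewrite !gt_eqF // addr_gt0 // exprn_gt0.
have p0 : expR r + 1 != 0 by rewrite gt_eqF // addr_gt0 ?expR_gt0.
have key : 3 * tanh (r / 2) ^+ 2 - 1 =
    2 * (expR r - (2 + Num.sqrt 3)) * (expR r - (2 - Num.sqrt 3)) / (expR r + 1) ^+ 2.
  rewrite tE.
  transitivity (2 * ((expR r - 2) ^+ 2 - Num.sqrt 3 ^+ 2) / (expR r + 1) ^+ 2).
    by rewrite s3; field.
  by field.
have pos : 0 < 2 + (Num.sqrt 3 : R) by lra.
split=> [rE|/eqP].
  apply/eqP; rewrite -subr_eq0 key rE lnK ?posrE // subrr mulr0 !mul0r //.
rewrite -subr_eq0 key !mulf_eq0 pnatr_eq0 invr_eq0 expf_eq0 /= (negbTE p0) orbF.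
rewrite !subr_eq0 => /orP[/eqP <-|/eqP h]; first by rewrite expRK.
by move: E1; rewrite h; lra.
Qed.

End TanhSpecial.

(** * Eigenspaces of the shape operator in the left-invariant frame *)

Section Eigen.
Context {R : realType} {m : nat}.
Notation Ga := 'rV[R]_(m + m).
Notation V := 'rV[R]_(1 + (m + m) + 1).
Implicit Types (x : V) (u v y : Ga).
Variables (w : {vspace Ga}) (q : Ga) (tau kap D : R).
Hypothesis qo : q \in orthcv w.
Hypothesis qq : dot q q = D.
Hypothesis totally_real : forall v, v \in orthcv w -> oproj w (Ja v) = 0.
Hypothesis tau01 : 0 < tau < 1.
Hypothesis kapE : kap = (1 - tau ^+ 2) / (2 * tau).
Hypothesis kapD : kap * D = 2 * tau.
Notation j := (Ja q).

(** [tangent_hat] and the eigenvalue equation of [shape_hat], with [q], [tau], [kap] and [D]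
    abstracted to parameters tied by the algebraic hypotheses above. *)
Definition eigen_hat (l : R) : set V := [set x | 2 * dot q (cU x) = ca x * D /\
  mk (2^-1 * kap * dot (cU x) q)
     (kap *: (oproj w (cU x) - (2^-1 * ca x) *: q) + (2^-1 * tau) *: cU x
        - (2^-1 * kap * cz x) *: Ja q)
     (tau * cz x + 2^-1 * kap * dot (Ja (cU x)) q) = l *: x].

(** The candidate eigenvector in the plane of Jq and Z, scaled to have Z coordinate 1. The Jq
    component of the eigenvalue equation forces its coefficient; the Z component then says that
    [chi tau l] is 0. *)
Definition evec (l : R) : V := mk 0 ((kap / (tau - 2 * l)) *: j) 1.

Let tau_gt0 : 0 < tau. Proof. by case/andP: tau01. Qed.
Let tau_neq0 : tau != 0. Proof. by rewrite gt_eqF. Qed.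
Let tau2_lt1 : tau ^+ 2 < 1.
Proof. by case/andP: tau01 => t0 t1; rewrite expr_lt1 // ltW. Qed.
Let kap_gt0 : 0 < kap.
Proof. by rewrite kapE divr_gt0 ?mulr_gt0 // subr_gt0. Qed.
Let kap2D : kap ^+ 2 * D = 1 - tau ^+ 2.
Proof. by rewrite expr2 -mulrA kapD kapE; field. Qed.

Let D_gt0 : 0 < D.
Proof. by rewrite -(pmulr_rgt0 _ kap_gt0) kapD mulr_gt0. Qed.

Let q_neq0 : q != 0.
Proof. by rewrite -dot_gt0 qq. Qed.

Let jw : j \in w.
Proof. by rewrite -oproj_eq0 totally_real. Qed.

Let jj : dot j j = D. Proof. by rewrite dot_JaJa. Qed.

Let j_neq0 : j != 0.
Proof. by rewrite -dot_gt0 jj. Qed.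

Let dot_jo u : u \in orthcv w -> dot j u = 0.
Proof. by move=> uo; rewrite dotC (dot_orthcv uo jw). Qed.

Let dot_Jaq u : dot (Ja u) q = - dot j u.
Proof. exact: dot_Ja. Qed.

(** Away from [tau / 2] the B component of [x] vanishes. Projecting to the complement of [w] then
    isolates [y], and total reality confines the rest to the plane of Jq and Z. *)
Lemma eigen_hatP l x : l != 2^-1 * tau -> eigen_hat l x <->
  exists y b, [/\ y \in orthcv w, dot q y = 0, (kap + 2^-1 * tau - l) *: y = 0,
    chi tau l * b = 0 & x = mk 0 y 0 + b *: evec l].
Proof.
move=> lt.
have t2l : tau - 2 * l != 0.
  by apply: contra lt => /eqP e; apply/eqP; lra.
split=> [[xt e]|[y [b [yo qy ly cb ->]]]]; last first.
  rewrite /eigen_hat /evec /= !coordE mulr0 addr0 mulr0 !add0r mulr1.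
  have Qu : oproj w (y + b *: (kap / (tau - 2 * l) *: j)) = y.
    by rewrite oprojD !oprojZ totally_real // !scaler0 addr0 oproj_id.
  rewrite Qu mul0r dotDr !dotZr qy (dotC q j) dot_Ja_self !mulr0 addr0 mulr0.
  split=> //.
  rewrite (dotC _ q) dotDr !dotZr qy (dotC q j) dot_Ja_self !mulr0 addr0 mulr0.
  rewrite dot_Jaq dotDr !dotZr (dot_jo yo) jj add0r.
  rewrite mkZ mkD mkZ !mulr0 addr0 mulr1 add0r; congr mk; first by rewrite mulr0.
    rewrite scale0r subr0.
    have -> : kap *: y = l *: y - (2^-1 * tau) *: y.
      by apply/eqP; rewrite -subr_eq0 -!scalerBl -ly; apply/eqP; congr (_ *: _); ring.
    by apply/rowP => i; rewrite !mxE; field.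
  apply/eqP; rewrite -subr_eq0; apply/eqP.
  transitivity (chi tau l * b * 2 / (tau - 2 * l)); last by rewrite cb !mul0r.
  transitivity ((tau - l) * b - 2^-1 * (kap ^+ 2 * D) * b / (tau - 2 * l)).
    by field.
  by rewrite kap2D /chi; field.
move: e; rewrite -[x in RHS]mk_eta mkZ => /mk_inj[e1 e2 e3].
(* Tangency and [kapD] turn the B component of the equation into [2^-1 * tau * ca x = l * ca x]. *)
have a0 : ca x = 0.
  move: e1; rewrite dotC => e1.
  have : (l - 2^-1 * tau) * ca x = 0.
    rewrite mulrBl -e1.
    have -> : dot q (cU x) = 2^-1 * (ca x * D) by rewrite -xt; field.
    transitivity (4^-1 * ca x * (kap * D - 2 * tau)); first by field.
    by rewrite kapD subrr mulr0.
  by move/eqP; rewrite mulf_eq0 subr_eq0 (negbTE lt) => /eqP.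
move: xt e2; rewrite a0 mul0r mulr0 scale0r subr0 => /eqP.
rewrite mulf_eq0 pnatr_eq0 /= => /eqP qu e2.
pose y := oproj w (cU x).
have ly : (kap + 2^-1 * tau - l) *: y = 0.
  have := congr1 (oproj w) e2; rewrite -scaleNr !oprojD !oprojZ oprojK.
  rewrite totally_real // scaler0 addr0 -/y => e.
  by rewrite scalerBl scalerDl e subrr.
have uE : cU x = y + (cz x * (kap / (tau - 2 * l))) *: j.
  have k : (2^-1 * tau - l) *: (cU x - y) = (2^-1 * kap * cz x) *: j.
    apply/eqP; rewrite -subr_eq0; apply/eqP.
    transitivity ((kap *: y + (2^-1 * tau) *: cU x - (2^-1 * kap * cz x) *: j - l *: cU x)
      - (kap + 2^-1 * tau - l) *: y); last by rewrite e2 subrr ly subrr.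
    by apply/rowP => i; rewrite !mxE; ring.
  rewrite -[LHS](subrK y) addrC; congr (_ + _).
  have e1' : 1 = 2 / (tau - 2 * l) * (2^-1 * tau - l) by field.
  transitivity ((2 / (tau - 2 * l) * (2^-1 * tau - l)) *: (cU x - y)).
    by rewrite -e1' scale1r.
  by rewrite -scalerA k scalerA; congr (_ *: _); field.
exists y, (cz x); split => //; first exact: oproj_mem.
- by rewrite dot_oproj.
- move: e3; rewrite dot_Jaq uE dotDr dotZr jj (dot_jo (oproj_mem _ _)) add0r => e3.
  have : tau * cz x + 2^-1 * kap * - (cz x * (kap / (tau - 2 * l)) * D) - l * cz x = 0.
    by rewrite e3 subrr.
  move=> e4.
  have -> : chi tau l * cz x = (2^-1 * tau - l) *
   (tau * cz x + 2^-1 * kap * - (cz x * (kap / (tau - 2 * l)) * D) - l * cz x).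
    transitivity ((2^-1 * tau - l) * ((tau - l) * cz x) - 4^-1 * (kap ^+ 2 * D) * cz x).
      by rewrite kap2D /chi; field.
    by field.
  by rewrite e4 mulr0.
- rewrite /evec mkZ mkD scalerA !mulr0 addr0 mulr1 add0r -uE -{1}a0.
  by rewrite mk_eta.
Qed.

(** For this eigenvalue the terms in [cU x] cancel, and the g_alpha component equates a vector of
    the complement of [w] with a multiple of Jq, which lies in [w]. Both must vanish. *)
Lemma eigen_hat_halfP x : eigen_hat (2^-1 * tau) x <->
  exists u, [/\ u \in w, dot u j = 0 & x = ca x *: mk 1 (2^-1 *: q) 0 + mk 0 u 0].
Proof.
split=> [[xt e]|[u [uw uj ->]]]; last first.
  have qu : dot q u = 0 by rewrite (dot_orthcv qo uw).
  rewrite /eigen_hat /= !coordE mulr1 !mulr0 !addr0 ?mulr0 scale0r subr0 add0r.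
  set a := ca x; have -> : oproj w (a *: (2^-1 *: q) + u) = (a / 2) *: q.
    rewrite oprojD !oprojZ (oproj_id qo) scalerA.
    by have := oproj_eq0 w u; rewrite uw => /eqP ->; rewrite addr0.
  rewrite dotDr !dotZr qu qq addr0; split; first by field.
  rewrite (dotC _ q) dotDr !dotZr qu qq addr0 dot_Jaq dotDr !dotZr dot_Ja_self.
  rewrite (dotC j) uj !mulr0 addr0 oppr0 mulr0.
  rewrite mkZ mkD mkZ; congr mk; last by rewrite !mulr0 addr0 mulr0.
    transitivity (4^-1 * a * (kap * D)); first by field.
    by rewrite kapD; field.
  by apply/rowP => i; rewrite !mxE; field.
move: e; rewrite -[x in RHS]mk_eta mkZ => /mk_inj[e1 e2 e3].
have kap_neq0 : kap != 0 by rewrite gt_eqF.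
pose y := oproj w (cU x) - (2^-1 * ca x) *: q.
have Qe : kap *: y = 0.
  have yo : y \in orthcv w by rewrite memvB ?memvZ ?oproj_mem.
  have := congr1 (oproj w) e2; rewrite -/y -scaleNr 2!oprojD !oprojZ (oproj_id yo).
  rewrite totally_real // scaler0 addr0 => /eqP.
  by rewrite -subr_eq0 addrK => /eqP.
have y0 : y = 0 by move/eqP: Qe; rewrite scaler_eq0 (negbTE kap_neq0) => /eqP.
have b0 : cz x = 0.
  move: e2; rewrite -/y y0 scaler0 add0r => /eqP.
  rewrite -subr_eq0 addrAC subrr add0r oppr_eq0 scaler_eq0 (negbTE j_neq0) orbF.
  by rewrite !mulf_eq0 invr_eq0 pnatr_eq0 (negbTE kap_neq0) => /eqP.
have ju : dot j (cU x) = 0.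
  move: e3; rewrite b0 !mulr0 add0r dot_Jaq => /eqP.
  by rewrite !mulf_eq0 invr_eq0 pnatr_eq0 (negbTE kap_neq0) oppr_eq0 => /eqP.
exists (cU x - oproj w (cU x)); split; first exact: oproj_sub.
  by rewrite dotC dotBr ju (dot_jo (oproj_mem _ _)) subrr.
rewrite mkZ mkD mulr1 addr0 mulr0 add0r -[LHS]mk_eta b0; congr mk.
move/eqP: y0; rewrite /y subr_eq0 => /eqP {1}->.
by rewrite scalerA [_ * 2^-1]mulrC addrC subrK.
Qed.

Let l4E : kap + 2^-1 * tau = (2 * tau)^-1.
Proof. by rewrite kapE; field. Qed.

(** The direction B + q/2 makes up for the direction Jq removed from [w]. *)
Lemma has_dim_eigen_half : has_dim (eigen_hat (2^-1 * tau)) (\dim w).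
Proof.
pose e : V := mk 1 (2^-1 *: q) 0.
have e_neq0 : e != 0.
  apply/eqP => e0; have := congr1 (@ca R m) e0.
  by rewrite (gone_mk : 0 = _) /e !mkK => /eqP; rewrite oner_eq0.
exists (<[e]> + linfun gemb @: (w :&: orthcv <[j]>))%VS; split.
  apply/seteqP; split=> x /=.
    move=> /eigen_hat_halfP[u [uw uj xE]].
    rewrite xE; apply: memv_add; first by rewrite memvZ // memv_line.
    by apply: gemb_mem; rewrite memv_cap uw; apply/orthcv_lineP.
  move=> /memv_addP[_ /vlineP[a ->] [y /mem_gemb[u + ->] xE]].
  rewrite memv_cap => /andP[uw /orthcv_lineP uj].
  apply/eigen_hat_halfP; exists u; split=> //.
  by rewrite {2}xE xE /e !coordE mulr1 addr0.
rewrite dimv_disjoint_sum ?dim_vline ?dim_gemb.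
  by rewrite e_neq0 -(dim_cap_orthcv_line jw j_neq0).
apply/eqP; rewrite -subv0; apply/subvP => x /memv_capP[/vlineP[a ->] /mem_gemb[u _]].
rewrite /e mkZ => /mk_inj[+ _ _]; rewrite mulr1 memv0 => ->.
by rewrite mul0r !scale0r -gone_mk.
Qed.

(** The two summands in [eigen_hatP] are independent, so their dimensions add. Keeping the count as
    a sum also covers the case where lambda_2 and lambda_4 coincide. *)
Lemma has_dim_eigen l : l != 2^-1 * tau -> has_dim (eigen_hat l)
  (addn (if l == (2 * tau)^-1 then (\dim (orthcv w)).-1 else 0%N) (chi tau l == 0)).
Proof.
move=> lt.
pose A := if l == (2 * tau)^-1 then (orthcv w :&: orthcv <[q]>)%VS else 0%VS.
pose L := if chi tau l == 0 then <[evec l]>%VS else 0%VS.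
exists (linfun gemb @: A + L)%VS; split.
  apply/seteqP; split=> x /=.
    move=> /(eigen_hatP _ lt)[y [b [yo qy ly cb ->]]].
    apply: memv_add.
      apply: gemb_mem; rewrite /A; case: eqVneq => [_|l4].
        by rewrite memv_cap yo; apply/orthcv_lineP; rewrite dotC.
      move/eqP: ly; rewrite scaler_eq0 l4E subr_eq0 eq_sym (negbTE l4) /= => /eqP ->.
      exact: mem0v.
    rewrite /L; case: eqVneq => [_|c0]; first by rewrite memvZ // memv_line.
    by move/eqP: cb; rewrite mulf_eq0 (negbTE c0) /= => /eqP ->; rewrite scale0r mem0v.
  move=> /memv_addP[y0 /mem_gemb[y yA ->] [z zL ->]].
  apply/(eigen_hatP _ lt).
  have [b [-> cb]] : exists b, z = b *: evec l /\ chi tau l * b = 0.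
    move: zL; rewrite /L; case: eqVneq => [-> /vlineP[b ->]|_].
      by exists b; rewrite mul0r.
    by rewrite memv0 => /eqP ->; exists 0; rewrite scale0r mulr0.
  exists y, b; split => //.
  - by move: yA; rewrite /A; case: ifP => _; [case/memv_capP|rewrite memv0 => /eqP ->; rewrite mem0v].
  - move: yA; rewrite /A; case: ifP => _; last by rewrite memv0 => /eqP ->; rewrite dot0r.
    by case/memv_capP => _ /orthcv_lineP; rewrite dotC.
  - move: yA; rewrite /A l4E; case: eqVneq => [->|_]; first by rewrite subrr scale0r.
    by rewrite memv0 => /eqP ->; rewrite scaler0.
rewrite dimv_disjoint_sum ?dim_gemb.
  congr (_ + _)%N; rewrite /A /L; case: ifP => _; rewrite ?dimv0 //.
    by rewrite -(dim_cap_orthcv_line qo q_neq0).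
  rewrite dim_vline; congr nat_of_bool; apply/eqP => e0.
  have := congr1 (@cz R m) e0; rewrite /evec mkK => /eqP.
  by rewrite (gone_mk : 0 = _) mkK oner_eq0.
apply/eqP; rewrite -subv0; apply/subvP => x /memv_capP[/mem_gemb[u _ xE] xL].
move: xL; rewrite /L; case: ifP => _ //; move=> /vlineP[b xE'].
have b0 : b = 0.
  have := congr1 (@cz R m) xE'; rewrite xE /evec !coordE mulr1 => <- //.
by rewrite xE' b0 scale0r mem0v.
Qed.

(* [mk 0 (- kap *: j) tau] is [J] of the inward normal in the left-invariant frame. *)
Lemma hopf_projection l : chi tau l = 0 -> exists Y,
  [/\ eigen_hat l Y, Y != 0 & forall z, eigen_hat l z -> vdot (mk 0 (- kap *: j) tau - Y) z = 0].
Proof.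
move=> cl.
have lt : l != 2^-1 * tau.
  by apply: contra (chi_half tau01) => /eqP <-; rewrite cl.
have t2l : tau - 2 * l != 0.
  by apply: contra lt => /eqP e; apply/eqP; lra.
set h := mk _ _ _; pose e := evec l.
have e_neq0 : e != 0.
  apply/eqP => e0; have := congr1 (@cz R m) e0; rewrite /e /evec mkK => /eqP.
  by rewrite (gone_mk : 0 = _) mkK oner_eq0.
have ee0 : vdot e e != 0 by rewrite gt_eqF // vdot_gt0.
have he : vdot h e != 0.
  rewrite /h /e /evec /vdot !mkK !dotE dot_JaJa qq mul0r add0r mulr1.
  apply/eqP => E.
  (* Orthogonality of [h] and [e] amounts to this relation; together with [chi tau l = 0] it would
     force [tau ^+ 2 = 1]. *)
  have k : 2 * tau ^+ 2 - 1 = 2 * l * tau.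
    apply/eqP; rewrite -subr_eq0; apply/eqP.
    transitivity ((tau - 2 * l) * (kap / (tau - 2 * l) * (- kap * D) + tau)); last first.
      by rewrite E mulr0.
    transitivity (tau * (tau - 2 * l) - kap ^+ 2 * D); first by rewrite kap2D; ring.
    by field.
  have : (1 - tau ^+ 2) ^+ 2 = 4 * tau ^+ 2 * chi tau l.
    transitivity ((2 * l * tau) ^+ 2 - 3 * tau ^+ 2 * (2 * l * tau) + 3 * tau ^+ 4 - tau ^+ 2).
      by rewrite -k; ring.
    by rewrite /chi; field.
  rewrite cl mulr0 => /eqP; rewrite sqrf_eq0 subr_eq0 => /eqP t1.
  by move: tau2_lt1; rewrite -t1 ltxx.
have eP := eigen_hatP _ lt.
(* The projection to the line of [e] is also the projection to a larger eigenspace, because [h] and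
   [e] are orthogonal to the complement of [w]. *)
exists ((vdot h e / vdot e e) *: e); split.
- apply/eP; exists 0, (vdot h e / vdot e e); split=> //.
  + exact: mem0v.
  + exact: dot0r.
  + exact: scaler0.
  + by rewrite cl mul0r.
  + by rewrite -gone_mk add0r.
- by rewrite scaler_eq0 negb_or e_neq0 mulf_neq0 ?invr_eq0.
move=> z /eP[y [b [yo qy _ _ ->]]].
have jy : dot j y = 0 by rewrite dotC (dot_orthcv yo jw).
rewrite vdotDr vdotZr !vdotDl !vdotNl !vdotZl -/e divfK // subrr mulr0 addr0.
by rewrite /h /e /evec /vdot !mkK !dotE jy; ring.
Qed.

End Eigen.

(** * Principal curvature spaces of the tube *)

Section PrincipalSpaces.
Context {R : realType} {m : nat}.
Notation Ga := 'rV[R]_(m + m).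
Notation V := 'rV[R]_(1 + (m + m) + 1).
Local Opaque dL dLinv gCH J.
Variables (w : {vspace Ga}) (r : R).
Hypothesis r_gt0 : 0 < r.
Hypothesis totally_real : forall v, v \in orthcv w -> oproj w (Ja v) = 0.
Let d : R := 4 * sinh (r / 2) ^+ 2.
Let tau : R := tanh (r / 2).
Let kap : R := (2 * sinh (r / 2) * cosh (r / 2))^-1.
Variables (eta : V -> V) (p : V).
Hypothesis ie : inward_unit_normal gCH (Worb w) r eta.
Hypothesis pM : cone_set w d p.
Let q : Ga := expR (- ca p / 2) *: oproj w (cU p).
Notation E := (principal_space gCH (cone_set w d) eta p).

Let sh0 : sinh (r / 2) != 0.
Proof. by rewrite gt_eqF // sinh_gt0 // divr_gt0. Qed.
Let ch0 : cosh (r / 2) != 0. Proof. exact: cosh_neq0. Qed.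
Let tau01 : 0 < tau < 1. Proof. exact: tanh_half_gt0_lt1. Qed.
Let kapE : kap = (1 - tau ^+ 2) / (2 * tau).
Proof.
rewrite /kap /tau tanhE.
transitivity ((cosh (r / 2) ^+ 2 - sinh (r / 2) ^+ 2) *
  (2 * sinh (r / 2) * cosh (r / 2))^-1); last by field; rewrite ?sh0 ?ch0.
by rewrite cosh2_sinh2 addrAC subrr add0r mul1r.
Qed.
Let kapD : kap * d = 2 * tau.
Proof. by rewrite /kap /d /tau tanhE; field; rewrite ?sh0 ?ch0. Qed.
Let qo : q \in orthcv w. Proof. exact: q_orthcv. Qed.
Let qq : dot q q = d. Proof. exact: dot_qq. Qed.

Lemma principal_space_eigen_hat l :
  E l = [set X | eigen_hat w q tau kap d l (dLinv p X)].
Proof. by apply/seteqP; split=> X /(principal_spaceP r_gt0 pM l X ie). Qed.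

Lemma has_dim_principal_half : has_dim (E (2^-1 * tau)) (\dim w).
Proof.
rewrite principal_space_eigen_hat.
apply: (has_dim_preim (linear_dL p) (dLK p) (dLVK p)).
exact: has_dim_eigen_half.
Qed.

Lemma has_dim_principal l : l != 2^-1 * tau -> has_dim (E l)
  (addn (if l == (2 * tau)^-1 then (\dim (orthcv w)).-1 else 0%N) (chi tau l == 0)).
Proof.
move=> lt; rewrite principal_space_eigen_hat.
apply: (has_dim_preim (linear_dL p) (dLK p) (dLVK p)).
exact: has_dim_eigen.
Qed.

Lemma hopf_principal_projection l : chi tau l = 0 ->
  exists2 Y, orth_proj (gCH p) (E l) (J p (eta p)) Y & Y != 0.
Proof.
move=> cl; have [Y [YE Y0 h]] := hopf_projection qo qq totally_real tau01 kapE kapD cl.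
have Je : dLinv p (J p (eta p)) = mk 0 (- kap *: Ja q) tau.
  transitivity (J0 (dLinv p (eta p))); first exact: dLK.
  rewrite (proj2 (proj1 (inward_unit_normalP w r_gt0 eta) ie)) //.
  by rewrite dLinv_normal_field // /J0 !mkK oppr0 JaZ.
exists (dL p Y); last first.
  apply: contra Y0 => /eqP e; apply/eqP.
  by rewrite -[LHS](dLK p) e -[in LHS](dL0 p) dLK.
rewrite principal_space_eigen_hat; split=> [|z zE]; first by rewrite /= dLK.
have hE : dLinv p (J p (eta p) - dL p Y) = mk 0 (- kap *: Ja q) tau - Y.
  by apply: etrans (dLinvB _ _ _) _; congr (_ - _); [exact: Je|exact: dLK].
by apply: etrans (gCHE _ _ _) _; rewrite hE; exact: h.
Qed.

End PrincipalSpaces.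

(** Here g_alpha is C^m with m = n - 1. Nonemptiness of the tube and existence of an inward normal
    keep the last, universally quantified clause from being vacuous. *)
Theorem mainTheorem2 (R : realType) (n k : nat) (r : R)
    (w : {vspace 'rV[R]_(n.-1 + n.-1)}) :
  (3 <= n)%N -> (2 <= k <= n.-1)%N -> 0 < r ->
  has_dim (orthc w) k -> constant_kahler_angle (orthc w) (pi / 2) ->
  let W := Worb w in
  let M := tube gCH W r in
  let th := tanh (r / 2) in
  let l1 := 3 / 4 * th - 2^-1 * Num.sqrt (1 - 3 / 4 * th ^+ 2) in
  let l2 := 3 / 4 * th + 2^-1 * Num.sqrt (1 - 3 / 4 * th ^+ 2) in
  let l3 := 2^-1 * th in
  let l4 := 2^-1 * coth (r / 2) in
  [/\ M !=set0, smooth_hypersurface M,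
      exists eta, inward_unit_normal gCH W r eta
    & forall eta, inward_unit_normal gCH W r eta -> forall p, M p ->
      let E := principal_space gCH M eta p in
      [/\ principal_curvature gCH M eta p = [set l1; l2; l3; l4],
          r <> ln (2 + Num.sqrt 3) ->
            uniq [:: l1; l2; l3; l4] /\
            [/\ has_dim (E l1) 1, has_dim (E l2) 1,
                has_dim (E l3) (2 * n - 2 - k) & has_dim (E l4) (k - 1)],
          forall l : R, l = l1 \/ l = l2 ->
            exists2 Y, orth_proj (gCH p) (E l) (J p (eta p)) Y & Y != 0
        & r = ln (2 + Num.sqrt 3) ->
            [/\ l1 = 0, l2 = l4, l4 = Num.sqrt 3 / 2 & l3 = Num.sqrt 3 / 6] /\
            [/\ has_dim (E l1) 1, has_dim (E l2) k
              & has_dim (E l3) (2 * n - k - 2)]]].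
Proof.
move=> n3 /andP[k2 kn].
have k0 : (0 < k)%N by lia.
(* This bound and the next make lambda_4 and lambda_3 actually occur as eigenvalues. *)
have k1 : (0 < k.-1)%N by lia.
have kw : (0 < 2 * n - 2 - k)%N by lia.
have dw x : (k + x = n.-1 + n.-1)%N -> x = (2 * n - 2 - k)%N by lia.
move=> r0 dimk kah W M th l1 l2 l3 l4.
have tr v : v \in orthcv w -> oproj w (Ja v) = 0 by exact: totally_real_oproj.
have ok : \dim (orthcv w) = k by exact: has_dim_orthcv.
have wk : \dim w = (2 * n - 2 - k)%N by apply: dw; rewrite -{1}ok dim_orthcv.
rewrite /M {M} /W {W} (tubeE w r0).
have s0 : 0 < sinh (r / 2) by rewrite sinh_gt0 // divr_gt0.
have t01 : 0 < th < 1 := tanh_half_gt0_lt1 r0.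
have l4E : l4 = (2 * th)^-1.
  by rewrite /l4 /th cothE tanhE; field; rewrite cosh_neq0 gt_eqF.
have l3l4 : l3 != (2 * th)^-1 by exact: half_neq_inv.
have l1l2 : l1 != l2 by rewrite lt_eqF // root1_lt_root2.
have l4l1 : (2 * th)^-1 != l1 by exact: root1_neq_inv.
have chiE l : (chi th l == 0) = (l == l1) || (l == l2) by exact: chi_eq0.
have c3 : chi th l3 != 0 by exact: chi_half.
have [l31 l32] : l3 != l1 /\ l3 != l2.
  by apply/andP; rewrite -negb_or -chiE.
have spE := tanh_half_special r0; rewrite -/th in spE.
have c4 : (chi th (2 * th)^-1 == 0) = (3 * th ^+ 2 == 1) by exact: chi_inv_eq0.
split.
- have ok0 : (orthcv w != 0)%VS by rewrite -dimv_eq0 ok -lt0n.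
  pose v := vpick (orthcv w).
  have vo : v \in orthcv w by exact: memv_pick.
  have v0 : 0 < dot v v by rewrite dot_gt0 vpick0.
  (* Any nonzero [v] normal to [w] lies over a point of the cone: the first coordinate is chosen to
     match its length. *)
  exists (mk (ln (dot v v / (4 * sinh (r / 2) ^+ 2))) v 0).
  have d0 : 0 < 4 * sinh (r / 2) ^+ 2 by rewrite mulr_gt0 // exprn_gt0.
  rewrite /cone_set /= !mkK oproj_id // lnK ?posrE ?divr_gt0 //.
  by rewrite mulrCA mulfV ?mulr1 // gt_eqF.
- exact: (smooth_hypersurface_cone_set r0).
- by exists (normal_field w r); exact: inward_normal_field.
move=> eta ie p pM; set E := principal_space _ _ eta p.
have dimE l : l != l3 -> has_dim (E l)
  (addn (if l == (2 * th)^-1 then k.-1 else 0%N) ((l == l1) || (l == l2))).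
  move=> ll; rewrite -ok -chiE; exact: has_dim_principal.
have dim3 : has_dim (E l3) (2 * n - 2 - k) by rewrite -wk; exact: has_dim_principal_half.
split.
- apply/seteqP; split=> l.
    move=> h; have [->|ll] := eqVneq l l3; first by left; right.
    have := proj1 (has_dim_neq0 (dimE l ll)) h.
    have [->|_] := eqVneq l l1; first by left; left; left.
    have [->|_] := eqVneq l l2; first by left; left; right.
    by rewrite -l4E; case: eqVneq => [->|//]; right.
  move=> h.
  have [e|ll] := eqVneq l l3.
    by apply/(has_dim_neq0 (e := 2 * n - 2 - k)); rewrite ?e.
  apply/(has_dim_neq0 (dimE l ll)).
  case: h => [[[->|->]|e]|->].
  + by rewrite eqxx addn1.
  + by rewrite eqxx orbT addn1.
  + by rewrite e eqxx in ll.
  + by rewrite l4E eqxx addn_gt0 k1.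
- move=> rn.
  have s3 : 3 * th ^+ 2 != 1 by apply/eqP => /spE.
  have l4l2 : (2 * th)^-1 != l2.
    by move: s3; rewrite -c4 chiE negb_or => /andP[].
  split.
    rewrite l4E /= !inE !negb_or l1l2 (eq_sym l1 l3) l31 (eq_sym l1) l4l1.
    by rewrite (eq_sym l2 l3) l32 (eq_sym l2) l4l2 l3l4.
  split => //.
  + by have := dimE l1; rewrite eq_sym l31 (eq_sym l1) (negbTE l4l1) eqxx; exact.
  + have := dimE l2; rewrite eq_sym l32 (eq_sym l2) (negbTE l4l2) eqxx orbT.
    by exact.
  + have := dimE l4; rewrite l4E eqxx (negbTE l4l1) (negbTE l4l2) addn0 eq_sym l3l4.
    by rewrite subn1; exact.
- move=> l h; apply: hopf_principal_projection => //.
  by apply/eqP; rewrite chiE; case: h => ->; rewrite eqxx ?orbT.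
- move=> /spE sp; have [v1 v2 v4 v3] := special_values t01 sp.
  split; first by rewrite l4E; split.
  split.
  + by have := dimE l1; rewrite eq_sym l31 (eq_sym l1) (negbTE l4l1) eqxx; exact.
  + have := dimE l2; rewrite eq_sym l32 => /(_ isT).
    (* Both summands of [dimE] contribute here: [k.-1] from the complement of [w] orthogonal to [q],
       and 1 from the plane of Jq and Z. *)
    have ek : addn k.-1 true = k by rewrite addn1 prednK.
    have e2 : l2 == (2 * th)^-1 by apply/eqP.
    by rewrite e2 eqxx orbT ek.
  + by rewrite subnAC.
Qed.
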